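(* Let $(X_n)_{n\ge 1}$ be an associated sequence of mean-zero random variables defined on the same probability space $(\Omega,\mathcal{A},\mathbb{P})$, and put $S_0=0$, $S_n=X_1+\cdots+X_n$ and $s_n^2=\mathrm{Var}(S_n)$. (i) If the sequence is stationary, with $\mathbb{E}X_1^2<+\infty$ and $$\sigma^2=\mathrm{Var}(X_1)+2\sum_{j=2}^{\infty}\mathrm{Cov}(X_1,X_j)<+\infty,$$ then $S_n/\sqrt{n}$ converges weakly to $\mathcal{N}(0,\sigma^2)$ as $n\to+\infty$. (ii) In general (without stationarity), suppose that there exist a sequence $(\ell(n))_{n\ge1}$ of positive integers and a real $\delta>0$ such that, writing $n=m(n)\ell(n)+r(n)$ with integers $m(n)\ge 0$ and $0\le r(n)<\ell(n)$, the following hold as $n\to+\infty$: - $m(n)\to+\infty$, $\ell(n)/n\to 0$ and $r(n)/n\to 0$; - $\dfrac{\ell(n)}{s_n^2}\to 0$; - $\dfrac{\ell(n)}{s_n^2}\displaystyle\sum_{j=1}^{m(n)}\mathrm{Var}\left(\frac{S_{j\ell(n)}-S_{(j-1)\ell(n)}}{\sqrt{\ell(n)}}\right)\to 1$; - $\displaystyle\sup_{1\le j\le m(n)+1}\frac{\ell(n)}{s_n^2}\mathrm{Var}\left(\frac{S_{j\ell(n)}-S_{(j-1)\ell(n)}}{\sqrt{\ell(n)}}\right)\to 0$; - $\mathbb{E}|X_j|^{2+\delta}<+\infty$ for all $j\ge1$, and $$\frac{\ell(n)^{(2+\delta)/2}}{s_n^{2+\delta}}\sum_{j=1}^{m(n)}\mathbb{E}\left|\frac{S_{j\ell(n)}-S_{(j-1)\ell(n)}}{\sqrt{\ell(n)}}\right|^{2+\delta}\to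 0.$$ Then $S_n/s_n$ converges weakly to $\mathcal{N}(0,1)$ as $n\to+\infty$.
   Context: A finite family $(X_1,\dots,X_n)$ of real random variables is associated if for any two real-valued coordinate-wise non-decreasing functions $h,g$ on $\mathbb{R}^n$ one has $\mathrm{Cov}(h(X_1,\dots,X_n),g(X_1,\dots,X_n))\ge 0$ whenever this covariance exists. An infinite sequence is associated if all its finite subfamilies are associated. $s_n$ is the nonnegative square root of $s_n^2$; in part (ii), $s_n>0$ for all large $n$ (implicit in dividing by $s_n$). $\mathcal{N}(0,\sigma^2)$ is the normal law with mean $0$ and variance $\sigma^2$ (the point mass at $0$ if $\sigma=0$). *)

(* Defs.v *)
From HB Require Import structures.
From mathcomp Require Import all_boot all_order all_algebra.
From mathcomp Require Import all_classical all_reals all_analysis.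
Import Order.TTheory GRing.Theory Num.Theory.
Import numFieldNormedType.Exports.

Set Implicit Arguments.
Unset Strict Implicit.
Unset Printing Implicit Defensive.

Local Open Scope classical_set_scope.
Local Open Scope ring_scope.

(* A sequence [X : nat -> {RV P >-> R}] stands for the family (X_1, X_2, ...)
   shifted by one: [X i] is X_(i+1). *)

Section Sequences.
Context (d : measure_display) (T : measurableType d) (R : realType).
Variable P : probability T R.

Definition subvector (X : nat -> {RV P >-> R}) (n : nat) (idx : 'I_n -> nat)
    (w : T) : n.-tuple R :=
  [tuple X (idx i) w | i < n].

Definition coordinatewise_nondecreasing (n : nat) (h : n.-tuple R -> R) : Prop :=
  forall x y : n.-tuple R, (forall i, tnth x i <= tnth y i) -> h x <= h y.

(* [h] and [g] are not assumed to be Borel: existence of the covariance means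
   that h(Y), g(Y) and h(Y) g(Y) are measurable and integrable. *)
Definition associated_vector (n : nat) (Y : T -> n.-tuple R) : Prop :=
  forall h g : n.-tuple R -> R,
    coordinatewise_nondecreasing h -> coordinatewise_nondecreasing g ->
    h \o Y \in Lfun P 1 -> g \o Y \in Lfun P 1 ->
    (fun w => h (Y w) * g (Y w)) \in Lfun P 1 ->
    (0 <= covariance P (h \o Y) (g \o Y))%E.

Definition associated (X : nat -> {RV P >-> R}) : Prop :=
  forall (n : nat) (idx : 'I_n -> nat), injective idx ->
    associated_vector (subvector X idx).

Definition stationary (X : nat -> {RV P >-> R}) : Prop :=
  forall (k n : nat) (A : set (n.-tuple R)), measurable A ->
    P (subvector X (fun i : 'I_n => (k + i)%N) @^-1` A) =
    P (subvector X (fun i : 'I_n => i : nat) @^-1` A).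

Definition partial_sum (X : nat -> {RV P >-> R}) (n : nat) (w : T) : R :=
  \sum_(i < n) X i w.

(* [fine] turns an infinite variance into 0; the value is meaningful only for
   square-integrable sums. *)
Definition sum_std (X : nat -> {RV P >-> R}) (n : nat) : R :=
  Num.sqrt (fine ('V_P[partial_sum X n])%E).

Definition scaled_block (X : nat -> {RV P >-> R}) (l j : nat) (w : T) : R :=
  (partial_sum X (j * l) w - partial_sum X (j.-1 * l) w) / Num.sqrt l%:R.

(* Var(X_1) + 2 \sum_(j >= 2) Cov(X_1, X_j) *)
Definition limit_variance (X : nat -> {RV P >-> R}) : \bar R :=
  ('V_P[X 0%N] + 2%:E * \sum_(1 <= j <oo) covariance P (X 0%N) (X j))%E.

Definition weakly_converges (Y : nat -> T -> R) (mu : probability (measurableTypeR R) R) : Prop :=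
  forall f : R -> R, continuous f -> bounded_fun f ->
    'E_P[f \o Y n]%E @[n --> \oo] --> (\int[mu]_x (f x)%:E)%E.

End Sequences.

(* Normal law of mean [m] and variance [v]. The case [v = 0] is separate because
   [normal_prob m 0] is the uniform law on [0, 1]. *)
Definition normal_law (R : realType) (m v : R) : probability (measurableTypeR R) R :=
  if v == 0 then (dirac (m : measurableTypeR R) : probability (measurableTypeR R) R)
  else (normal_prob m (Num.sqrt v) : probability (measurableTypeR R) R).

(* Main.v *)
Require Import Defs.
From mathcomp Require Import all_boot all_order all_algebra.
From mathcomp Require Import all_classical all_reals all_analysis.
From mathcomp Require Import measurable_realfun ring lra.
Import Order.TTheory GRing.Theory Num.Theory.
Import numFieldNormedType.Exports.
Local Open Scope classical_set_scope.
Local Open Scope ring_scope.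
Set Implicit Arguments.
Unset Strict Implicit.
Unset Printing Implicit Defensive.

(** Both limit theorems cut [S_n] into blocks and replace the blocks one at a
    time by independent Gaussian variables of the same variance (Lindeberg's
    method); association takes over the role of independence.

    The test functions are the Gaussian bumps [x |-> gauss t (x - a)], where
    [gauss t] is the centred Gaussian density of variance [t].  Adding an
    independent Gaussian of variance [v] to the argument turns [gauss t] into
    [gauss (t + v)], so that no auxiliary probability space is needed: the
    replacement of a block [V] of variance [v] compares
    [E gauss t (U + V - a)] with [E gauss (t + v) (U - a)], where [U] is the sum
    of the earlier blocks.  Taylor's formula in space and the heat equation in
    time reduce the difference to [E (g'(U) V)] and [E (g''(U) (V^2 - v))], up to
    errors of order [E min(V^2, |V|^3)] and [v^2].  These two terms vanish under
    independence.  For an associated pair the covariance of an [A]-Lipschitz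
    function of [U] and a [B]-Lipschitz function of [V] is at most
    [A B Cov(U, V)] in absolute value ([cov_lipschitz_le]); this applies to [g'(U)] and [V], and to
    [g''(U)] and [V^2] once [V^2] is truncated at level 1.  The covariances
    [Cov(U, V)] add up to half the gap between the variance of the whole sum and
    the sum of the variances of the blocks ([lindeberg_sum]).  Hence
    [E gauss e (Y_n - a)] is close to [gauss (e + sigma^2) (- a)] as soon as this
    gap, the Lindeberg terms and the part of the sum left out by the blocks are
    small ([block_gauss_bound]).

    The limit [gauss (e + sigma^2) (- a)] is also [E gauss e (N - a)] for [N] of
    law [N(0, sigma^2)].  So the density of [Y_n] plus a small Gaussian noise
    converges pointwise to that of [N] plus the same noise, hence in [L^1] by
    Scheffe's lemma; bounded second moments allow the noise to be removed
    against a bounded continuous function ([weakly_converges_gauss]).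

    In the stationary case the blocks have a fixed length [l].  The increments
    [Var(S_(k+1)) - Var(S_k) = Var(X_1) + 2 sum_(2 <= j <= k+1) Cov(X_1, X_j)]
    increase to [sigma^2], so that [Var(S_l) / l] tends to [sigma^2] by Cesaro
    and the variance gap is at most [sigma^2 - Var(S_l) / l] after normalization:
    [n] tends to infinity first and [l] afterwards.  In the other case the
    variance is superadditive over consecutive blocks, since covariances are
    nonnegative.  As the normalized variances of the blocks add up to a quantity
    tending to 1, which is the normalized variance of the whole, both the gap and
    the variance of the last incomplete block tend to 0; the moment condition of
    order [2 + delta] controls the Lindeberg terms. *)

(** * Derivatives of real functions in pointwise form *)

Section DerivePointwise.
Variable R : realType.
Implicit Types (f g : R -> R) (x a b : R).

(** The rules of differentiation below are stated for [fun z => ...] terms, so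
    that explicit derivation trees can be composed and the resulting derivative
    checked by [ring] or [field]. *)
Lemma is_derive_add f g x a b : is_derive x 1 f a -> is_derive x 1 g b ->
  is_derive x 1 (fun z => f z + g z) (a + b).
Proof. by move=> ? ?; exact: is_deriveD. Qed.

Lemma is_derive_sub f g x a b : is_derive x 1 f a -> is_derive x 1 g b ->
  is_derive x 1 (fun z => f z - g z) (a - b).
Proof. by move=> ? ?; exact: is_deriveB. Qed.

Lemma is_derive_mul f g x a b : is_derive x 1 f a -> is_derive x 1 g b ->
  is_derive x 1 (fun z => f z * g z) (a * g x + f x * b).
Proof.
move=> df dg; apply: (is_derive_eq (is_deriveM df dg)).
by rewrite /GRing.scale/= addrC mulrC [f x * b]mulrC [a * _]mulrC mulrC.
Qed.

Lemma is_derive_const x a : is_derive x 1 (fun=> a) 0.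
Proof. exact: is_derive_cst. Qed.

Lemma is_derive_var x : is_derive x 1 (fun z => z) 1.
Proof. exact: is_derive_id. Qed.

Lemma is_derive_scale f x a b : is_derive x 1 f a ->
  is_derive x 1 (fun z => b * f z) (b * a).
Proof. by move=> df; exact: is_deriveZ. Qed.

Lemma is_derive_translate f x y a : is_derive (y + x) 1 f a ->
  is_derive x 1 (fun z => f (y + z)) a.
Proof.
move=> df; rewrite -[a]mulr1; apply: (@is_derive1_comp _ f (fun z => y + z)) => //.
by apply: (is_derive_eq (is_derive_add (is_derive_const _ _) (is_derive_var _))); rewrite add0r.
Qed.

Lemma is_derive_square x : is_derive x 1 (fun z => z ^+ 2) (2 * x).
Proof.
apply: (is_derive_eq (is_derive_mul (is_derive_var _) (is_derive_var _))).
by rewrite mul1r mulr1 mulr_natl.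
Qed.

End DerivePointwise.

(** * Mean value bounds and a Taylor formula of order two *)

Section MeanValueBounds.
Variable R : realType.

Lemma derive_bounded_lip (f df : R -> R) (C a b : R) : a <= b ->
  (forall z : R, a <= z <= b -> is_derive z 1 f (df z)) ->
  (forall z : R, a <= z <= b -> `|df z| <= C) ->
  `|f b - f a| <= C * (b - a).
Proof.
move=> ab fdf dfC.
have [||c] := @MVT_segment R f df a b ab.
- by move=> x; rewrite in_itv/= => /andP[ax xb]; apply: fdf; rewrite !ltW.
- apply: derivable_within_continuous => x; rewrite in_itv/= => /fdf h.
  exact: ex_derive.
rewrite in_itv/= => cab ->; rewrite normrM (@ger0_norm _ (b - a)) ?subr_ge0//.
by rewrite ler_wpM2r ?subr_ge0// dfC.
Qed.

Lemma derive_bounded_lipschitz (f df : R -> R) (C : R) :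
  (forall z : R, is_derive z 1 f (df z)) -> (forall z, `|df z| <= C) ->
  forall x y, `|f x - f y| <= C * `|x - y|.
Proof.
move=> fdf dfC x y; wlog xy : x y / y <= x => [wlg|].
  by have [/wlg//|/ltW/wlg] := leP y x; rewrite distrC [`|y - x|]distrC.
by rewrite (@ger0_norm _ (x - y)) ?subr_ge0//; apply: (@derive_bounded_lip f df).
Qed.

Lemma derive_bounded_at0 (f df : R -> R) (C y : R) :
  (forall z : R, `|z| <= `|y| -> is_derive z 1 f (df z)) ->
  (forall z, `|z| <= `|y| -> `|df z| <= C) ->
  `|f y - f 0| <= C * `|y|.
Proof.
move=> fdf dfC; have [y0|/ltW y0] := leP 0 y.
  rewrite (ger0_norm y0) -[X in C * X](subr0 y).
  apply: (@derive_bounded_lip f df) => // z /andP[z0 zy];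
    [apply: fdf|apply: dfC]; by rewrite !ger0_norm.
rewrite distrC (ler0_norm y0) -[X in C * X](sub0r y).
by apply: (@derive_bounded_lip f df) => // z /andP[z0 zy];
  [apply: fdf|apply: dfC]; rewrite !ler0_norm// lerN2.
Qed.

(** The size of a second-order Taylor remainder of a function whose second and
    third derivatives are bounded: cubic for small increments, and never worse
    than quadratic, which keeps it integrable when only second moments exist. *)
Definition cubic_cut (y : R) : R := Num.min (y ^+ 2) (`|y| ^+ 3).

(** The second derivative of the remainder is [u'' (x + z) - u'' x], which is
    bounded both by [2 C] and by [C |z|]; integrating either bound twice, with
    the mean value theorem, gives the quadratic and the cubic estimate. *)
Lemma taylor2_cubic_cut (u u1 u2 u3 : R -> R) (C : R) :
  (forall z : R, is_derive z 1 u (u1 z)) -> (forall z : R, is_derive z 1 u1 (u2 z)) ->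
  (forall z : R, is_derive z 1 u2 (u3 z)) ->
  (forall z, `|u2 z| <= C) -> (forall z, `|u3 z| <= C) ->
  forall x y, `|u (x + y) - u x - u1 x * y - u2 x * y ^+ 2 / 2| <=
    2 * C * cubic_cut y.
Proof.
move=> d0 d1 d2 C2 C3 x y.
pose r z := u (x + z) - u x - u1 x * z - u2 x * z ^+ 2 / 2.
pose r1 z := u1 (x + z) - u1 x - u2 x * z.
pose r2 z := u2 (x + z) - u2 x.
have dr (z : R) : is_derive z 1 r (r1 z).
  have e1 := is_derive_translate (d0 (x + z)).
  have e2 := is_derive_sub e1 (is_derive_const z (u x)).
  have e3 := is_derive_sub e2 (is_derive_scale (u1 x) (is_derive_var z)).
  have e4 := is_derive_scale (u2 x) (is_derive_square z).
  apply: (is_derive_eq (is_derive_sub e3 (is_derive_mul e4 (is_derive_const z 2^-1)))).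
  by rewrite /r1; field.
have dr1 (z : R) : is_derive z 1 r1 (r2 z).
  have e1 := is_derive_translate (d1 (x + z)).
  have e2 := is_derive_sub e1 (is_derive_const z (u1 x)).
  apply: (is_derive_eq (is_derive_sub e2 (is_derive_scale (u2 x) (is_derive_var z)))).
  by rewrite /r2; ring.
have r0 : r 0 = 0 by rewrite /r addr0; ring.
have r10 : r1 0 = 0 by rewrite /r1 addr0; ring.
have C0 : 0 <= C by apply: le_trans (C2 0).
(* A bound on the second derivative near 0 is integrated twice. *)
have twice (D : R) w : (forall z, `|z| <= `|w| -> `|r2 z| <= D) -> `|r w| <= D * `|w| ^+ 2.
  move=> hD.
  have h1 z : `|z| <= `|w| -> `|r1 z| <= D * `|w|.
    move=> zw; have D0 : 0 <= D by apply: le_trans (hD 0 _); rewrite ?normr0.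
    rewrite -(subr0 (r1 z)) -r10; apply: (@le_trans _ _ (D * `|z|)); last exact: ler_wpM2l.
    apply: (@derive_bounded_at0 r1 r2) => // z' z'z; apply: hD; exact: le_trans zw.
  rewrite -(subr0 (r w)) -r0 expr2 mulrA.
  exact: (@derive_bounded_at0 r r1).
have ha : `|r y| <= (2 * C) * `|y| ^+ 2.
  apply: twice => z _; apply: le_trans (ler_normB _ _) _.
  by rewrite mulrDl mul1r lerD.
have hb : `|r y| <= (C * `|y|) * `|y| ^+ 2.
  apply: twice => z zy; rewrite /r2.
  have := derive_bounded_lipschitz d2 C3 (x + z) x.
  rewrite addrAC subrr add0r => /le_trans; apply.
  exact: ler_wpM2l.
rewrite /cubic_cut real_normK ?num_real// in ha *.
rewrite -[X in `|X|]/(r y).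
rewrite minr_pMr ?mulr_ge0// le_min ha/=.
rewrite (le_trans hb)// -mulrA -exprS -mulrA ler_peMl ?ler1n//.
by rewrite mulr_ge0 ?exprn_ge0.
Qed.

End MeanValueBounds.

(** * The Gaussian kernel and the heat equation *)

Section GaussKernel.
Variable R : realType.
Implicit Types (t x : R).

(** The density of the centred normal law of variance [t].  Writing the factor
    [1 / sqrt t] as [exp (- ln t / 2)] puts all the dependence on [t] and [x]
    inside one exponential, which makes derivatives and products uniform. *)
Definition gauss t x : R :=
  (Num.sqrt (pi *+ 2))^-1 * expR (- (x ^+ 2 / 2 * t^-1 + ln t / 2)).

(** [gauss1], ..., [gauss4] are the successive derivatives in [x]. *)
Definition gauss1 t x : R := - (x * t^-1) * gauss t x.
Definition gauss2 t x : R := (x ^+ 2 * t^-1 ^+ 2 - t^-1) * gauss t x.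
Definition gauss3 t x : R := (x * t^-1 ^+ 2 *+ 3 - x ^+ 3 * t^-1 ^+ 3) * gauss t x.
Definition gauss4 t x : R :=
  (t^-1 ^+ 2 *+ 3 - x ^+ 2 * t^-1 ^+ 3 *+ 6 + x ^+ 4 * t^-1 ^+ 4) * gauss t x.

Lemma gauss_ge0 t x : 0 <= gauss t x.
Proof. by rewrite mulr_ge0 ?expR_ge0// invr_ge0. Qed.

Lemma gaussN t x : gauss t (- x) = gauss t x.
Proof. by rewrite /gauss sqrrN. Qed.

Lemma is_derive_gauss t x : is_derive x 1 (gauss t) (gauss1 t x).
Proof.
have e1 := is_derive_mul (is_derive_square x) (is_derive_const x 2^-1).
have e2 := is_derive_mul e1 (is_derive_const x t^-1).
have e3 := is_derive_scale (-1) (is_derive_add e2 (is_derive_const x (ln t / 2))).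
have e4 := @is_derive1_comp _ expR _ x _ _ (is_derive_expR _) e3.
have := is_derive_scale ((Num.sqrt (pi *+ 2))^-1) e4.
rewrite (_ : (fun _ => _) = gauss t); last first.
  by apply/funext => z; rewrite /gauss /= mulN1r.
move=> h; apply: (is_derive_eq h).
by rewrite /gauss1 /gauss /= mulN1r; move: (Num.sqrt _)^-1 => c; move: t^-1 (expR _) => s e; field.
Qed.

Lemma is_derive_gauss1 t x : is_derive x 1 (gauss1 t) (gauss2 t x).
Proof.
have e1 := is_derive_scale (-1) (is_derive_mul (is_derive_var x) (is_derive_const x t^-1)).
have := is_derive_mul e1 (is_derive_gauss t x).
rewrite (_ : (fun _ => _) = gauss1 t); last first.
  by apply/funext => z; rewrite /gauss1 mulN1r.
move=> h; apply: (is_derive_eq h).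
by rewrite /gauss2 /gauss1; ring.
Qed.

Lemma is_derive_gauss2 t x : is_derive x 1 (gauss2 t) (gauss3 t x).
Proof.
have e1 := is_derive_mul (is_derive_square x) (is_derive_const x (t^-1 ^+ 2)).
have e2 := is_derive_sub e1 (is_derive_const x t^-1).
apply: (is_derive_eq (is_derive_mul e2 (is_derive_gauss t x))).
by rewrite /gauss3 /gauss1; ring.
Qed.

Lemma is_derive_inv t : 0 < t -> is_derive t 1 (fun s : R => s^-1) (- t^-1 ^+ 2).
Proof.
move=> t0; have h := @is_deriveV _ (fun z : R => z) t 1 _ (lt0r_neq0 t0) (is_derive_var t).
by apply: (is_derive_eq h); rewrite /GRing.scale/= mulr1 exprVn.
Qed.

(** The heat equation: this is why bumps of variance [t] and [t + v] differ by
    [v / 2] times a second derivative in space, exactly as adding an independent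
    centred variable of variance [v] would produce. *)
Lemma is_derive_gauss_time t x : 0 < t ->
  is_derive t 1 (gauss^~ x) (gauss2 t x / 2).
Proof.
move=> t0.
have e2 := is_derive_scale (x ^+ 2 / 2) (is_derive_inv t0).
have e2' := is_derive_mul (is_derive1_ln t0) (is_derive_const t 2^-1).
have e3 := is_derive_scale (-1) (is_derive_add e2 e2').
have e4 := @is_derive1_comp _ expR _ t _ _ (is_derive_expR _) e3.
have := is_derive_scale ((Num.sqrt (pi *+ 2))^-1) e4.
rewrite (_ : (fun _ => _) = gauss^~ x); last first.
  by apply/funext => z; rewrite /gauss /= mulN1r.
move=> h; apply: (is_derive_eq h).
by rewrite /gauss2 /gauss /= mulN1r; move: (Num.sqrt _)^-1 => c; field; rewrite gt_eqF.
Qed.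

Lemma is_derive_gauss2_time t x : 0 < t ->
  is_derive t 1 (gauss2^~ x) (gauss4 t x / 2).
Proof.
move=> t0.
have e0 := is_derive_inv t0.
have e1 := is_derive_scale (x ^+ 2) (is_derive_mul e0 e0).
have e2 := is_derive_sub e1 e0.
have h := is_derive_mul e2 (is_derive_gauss_time x t0).
apply: (is_derive_eq h).
by rewrite /gauss4 /gauss2; field; rewrite gt_eqF.
Qed.

Lemma sqr_onep_expRN (h : R) : 0 <= h -> (1 + h) ^+ 2 * expR (- (h / 2)) <= 16.
Proof.
move=> h0; rewrite expRN ler_pdivrMr ?expR_gt0//.
have h20 : 0 <= h / 2 by rewrite divr_ge0.
have := expR_ge1Dxn 1 h20.
have -> : (2`!)%:R = 2 :> R by [].
move: (expR _) => e; nra.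
Qed.

(** With [h = x^2 / t] the kernel decays like [exp (- h / 2)], which dominates
    any polynomial in [h]; degree two in [h] is what four derivatives require. *)
Lemma gauss_time_bound t0 : 0 < t0 -> exists2 K, 0 <= K &
  forall t x, t0 <= t -> (1 + x ^+ 2 * t^-1) ^+ 2 * gauss t x <= K.
Proof.
move=> t0_gt0; exists ((Num.sqrt (pi *+ 2))^-1 * (16 * expR (- (ln t0 / 2)))).
  by rewrite !mulr_ge0 ?expR_ge0// invr_ge0.
move=> t x t0t; have t_gt0 : 0 < t by apply: lt_le_trans t0t.
have h0 : 0 <= x ^+ 2 * t^-1 by rewrite mulr_ge0 ?sqr_ge0// invr_ge0 ltW.
rewrite /gauss mulrCA ler_wpM2l ?invr_ge0// opprD expRD mulrA.
apply: ler_pM; rewrite ?expR_ge0// 1?mulr_ge0 ?exprn_ge0 ?addr_ge0 ?expR_ge0//.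
  rewrite (_ : x ^+ 2 / 2 * t^-1 = x ^+ 2 * t^-1 / 2); last by rewrite mulrAC.
  exact: sqr_onep_expRN.
by rewrite ler_expR lerN2 ler_pM2r// ler_ln// posrE.
Qed.

(** Each derivative is [gauss t x] times a polynomial in [1 / t] and [h = x^2 / t],
    and in [x / t] for the odd ones, for which [2 |x| / t <= 1 / t + h]. *)
Lemma gauss_derivatives_bound t0 : 0 < t0 -> exists2 C, 0 <= C &
  forall t x, t0 <= t -> [/\ `|gauss1 t x| <= C, `|gauss2 t x| <= C,
    `|gauss3 t x| <= C & `|gauss4 t x| <= C].
Proof.
move=> t0_gt0; have [K K0 hK] := gauss_time_bound t0_gt0.
pose j := t0^-1.
have j0 : 0 <= j by rewrite invr_ge0 ltW.
exists (3 * (1 + j) ^+ 2 * K); first by rewrite !mulr_ge0 ?exprn_ge0 ?addr_ge0.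
move=> t x t0t; have t_gt0 : 0 < t by apply: lt_le_trans t0t.
have {hK} := hK t x t0t.
pose i := t^-1; pose h := x ^+ 2 * i.
have i0 : 0 <= i by rewrite invr_ge0 ltW.
have ij : i <= j by rewrite lef_pV2 ?posrE.
have h0 : 0 <= h by rewrite mulr_ge0 ?sqr_ge0.
rewrite -/i -/h => hK.
have xi : `|x * i| <= (i + h) / 2.
  rewrite ler_norml; apply/andP; split.
    have := mulr_ge0 i0 (sqr_ge0 (x + 1)); rewrite /h; lra.
  have := mulr_ge0 i0 (sqr_ge0 (x - 1)); rewrite /h; lra.
have key (a : R) : `|a| <= (3 * (1 + j) ^+ 2) * (1 + h) ^+ 2 ->
    `|a * gauss t x| <= 3 * (1 + j) ^+ 2 * K.
  move=> ha; rewrite normrM (ger0_norm (gauss_ge0 t x)).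
  apply: (@le_trans _ _ ((3 * (1 + j) ^+ 2) * (1 + h) ^+ 2 * gauss t x)).
    by rewrite ler_wpM2r ?gauss_ge0.
  by rewrite -mulrA ler_wpM2l ?mulr_ge0 ?exprn_ge0 ?addr_ge0.
have hh : 1 <= 1 + h by rewrite lerDl.
have jj : 1 <= 1 + j by rewrite lerDl.
have ij2 : i ^+ 2 <= (1 + j) ^+ 2 by nra.
have ij1 : i <= (1 + j) ^+ 2 by nra.
split; apply: key.
- rewrite normrN; apply: le_trans xi _.
  nra.
- have -> : x ^+ 2 * t^-1 ^+ 2 - t^-1 = i * (h - 1) by rewrite /h /i; ring.
  rewrite normrM (ger0_norm i0).
  apply: (@le_trans _ _ ((1 + j) ^+ 2 * (1 + h) ^+ 2)).
    apply: ler_pM => //; rewrite ler_norml; apply/andP; split; nra.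
  by rewrite -mulrA ler_peMl ?mulr_ge0 ?exprn_ge0 ?addr_ge0 ?ler1n.
- have -> : x * t^-1 ^+ 2 *+ 3 - x ^+ 3 * t^-1 ^+ 3 = (x * i) * (i * (3 - h)).
    by rewrite /h /i; ring.
  rewrite normrM (normrM i) (ger0_norm i0).
  have h3 : `|3 - h| <= 3 * (1 + h) by rewrite ler_norml; apply/andP; split; nra.
  apply: (@le_trans _ _ (((i + h) / 2) * (i * (3 * (1 + h))))).
    by apply: ler_pM => //; rewrite ?mulr_ge0// ler_wpM2l.
  have h1 : (i + h) / 2 <= (1 + j) * (1 + h) by nra.
  have h2 : i * (3 * (1 + h)) <= (1 + j) * (3 * (1 + h)) by nra.
  rewrite [leRHS](_ : _ = (1 + j) * (1 + h) * ((1 + j) * (3 * (1 + h)))); last by ring.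
  by apply: ler_pM => //; [rewrite divr_ge0 ?addr_ge0 | rewrite !mulr_ge0 ?addr_ge0].
- have -> : t^-1 ^+ 2 *+ 3 - x ^+ 2 * t^-1 ^+ 3 *+ 6 + x ^+ 4 * t^-1 ^+ 4 =
      i ^+ 2 * (3 - h *+ 6 + h ^+ 2) by rewrite /h /i; ring.
  rewrite normrM (ger0_norm (exprn_ge0 _ i0)).
  have h3 : `|3 - h *+ 6 + h ^+ 2| <= 3 * (1 + h) ^+ 2.
    by rewrite ler_norml; apply/andP; split; nra.
  rewrite [leRHS](_ : _ = (1 + j) ^+ 2 * (3 * (1 + h) ^+ 2)); last by ring.
  by apply: ler_pM => //; rewrite exprn_ge0.
Qed.

(** The estimates on [gauss t] that the replacement of a block uses, with a
    constant that serves all variances [t >= t0]: along the replacement the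
    variance of the bump only grows. *)
Definition gauss_regular t0 C := forall t, t0 <= t ->
  [/\ forall x y, `|gauss t (x + y) - gauss t x - gauss1 t x * y - gauss2 t x * y ^+ 2 / 2|
        <= C * cubic_cut y,
      forall x v, 0 <= v -> `|gauss (t + v) x - gauss t x - v / 2 * gauss2 t x| <= C * v ^+ 2,
      forall x y, `|gauss1 t x - gauss1 t y| <= C * `|x - y|,
      forall x y, `|gauss2 t x - gauss2 t y| <= C * `|x - y| &
      forall x, `|gauss2 t x| <= C] /\
  [/\ forall x y, `|gauss t x - gauss t y| <= C * `|x - y| &
      forall s x, t0 <= s -> `|gauss t x - gauss s x| <= C * `|t - s|].

Lemma gauss_regularP t0 : 0 < t0 -> exists2 C, 0 < C & gauss_regular t0 C.
Proof.
move=> t0_gt0; have [C C0 hC] := gauss_derivatives_bound t0_gt0.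
have C1 : C <= 2 * C + 1 by lra.
have wC (a r : R) : 0 <= r -> a <= C * r -> a <= (2 * C + 1) * r.
  by move=> r0 /le_trans; apply; exact: ler_wpM2r.
have time t s x : t0 <= s -> s <= t ->
    `|gauss t x - gauss s x| <= C * (t - s).
  move=> t0s st.
  have := @derive_bounded_lip _ (gauss^~ x) (fun r => gauss2 r x / 2) C s t st.
  apply => z /andP[sz _].
    by apply: is_derive_gauss_time; rewrite (lt_le_trans t0_gt0)// (le_trans t0s).
  have [_ h _ _] := hC z x (le_trans t0s sz).
  rewrite normrM (ger0_norm (_ : 0 <= 2^-1)) ?invr_ge0//.
  by rewrite ler_pdivrMr// (le_trans h)// ler_peMr// ler1n.
exists (2 * C + 1); first by lra.
move=> t t0t; have t_gt0 := lt_le_trans t0_gt0 t0t.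
have b1 z : `|gauss1 t z| <= C by have [] := hC t z t0t.
have b2 z : `|gauss2 t z| <= C by have [] := hC t z t0t.
have b3 z : `|gauss3 t z| <= C by have [] := hC t z t0t.
split; split.
- move=> x y; apply: le_trans (taylor2_cubic_cut (is_derive_gauss t) (is_derive_gauss1 t)
    (is_derive_gauss2 t) b2 b3 x y) _.
  by rewrite ler_wpM2r ?lerDl// le_min sqr_ge0 exprn_ge0.
- move=> x v v0; apply: wC; first exact: sqr_ge0.
  pose f s := gauss (t + s) x - gauss t x - s * (gauss2 t x / 2).
  pose df s := gauss2 (t + s) x / 2 - gauss2 t x / 2.
  have -> : gauss (t + v) x - gauss t x - v / 2 * gauss2 t x = f v - f 0.
    by rewrite /f addr0; field.
  rewrite expr2 mulrA -[X in _ * X](subr0 v).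
  have := @derive_bounded_lip _ f df (C * v) 0 v v0.
  apply => z /andP[z0 zv].
    have tz : 0 < t + z by rewrite ltr_pwDl.
    have e1 := is_derive_translate (is_derive_gauss_time x tz).
    have e2 := is_derive_sub e1 (is_derive_const z (gauss t x)).
    have e3 := is_derive_mul (is_derive_var z) (is_derive_const z (gauss2 t x / 2)).
    by apply: (is_derive_eq (is_derive_sub e2 e3)); rewrite /df; ring.
  rewrite /df -mulrBl normrM (ger0_norm (_ : 0 <= 2^-1)) ?invr_ge0//.
  rewrite ler_pdivrMr//.
  have := @derive_bounded_lip _ (gauss2^~ x) (fun s => gauss4 s x / 2) C t (t + z).
  rewrite lerDl => /(_ z0) h; apply: le_trans (h _ _) _.
  + by move=> s /andP[ts _]; apply: is_derive_gauss2_time; exact: lt_le_trans ts.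
  + move=> s /andP[ts _]; have [_ _ _ h4] := hC s x (le_trans t0t ts).
    rewrite normrM (ger0_norm (_ : 0 <= 2^-1)) ?invr_ge0//.
    by rewrite ler_pdivrMr// (le_trans h4)// ler_peMr// ler1n.
  + rewrite addrAC subrr add0r -mulrA ler_wpM2l//.
    by rewrite (le_trans zv)// ler_peMr// ler1n.
- by move=> x y; apply: wC => //; exact: (derive_bounded_lipschitz (is_derive_gauss1 t) b2).
- by move=> x y; apply: wC => //; exact: (derive_bounded_lipschitz (is_derive_gauss2 t) b3).
- by move=> x; exact: le_trans (b2 x) C1.
- by move=> x y; apply: wC => //; exact: (derive_bounded_lipschitz (is_derive_gauss t) b1).
- move=> s x t0s; apply: wC => //; have [st|/ltW ts] := leP s t.
    by rewrite (ger0_norm (_ : 0 <= t - s)) ?subr_ge0//; exact: time.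
  by rewrite distrC [`|t - s|]distrC (ger0_norm (_ : 0 <= s - t)) ?subr_ge0//; exact: time.
Qed.

End GaussKernel.

(** * Square-integrable functions, means and covariances *)

Section Mean.
Context d (T : measurableType d) (R : realType) (P : probability T R).
Implicit Types (f g h : T -> R) (c : R).

Lemma Lfun_measurable p f : f \in Lfun P p -> measurable_fun setT f.
Proof. by rewrite inE => /andP[/[!inE]]. Qed.

Lemma Lfun1_dom f g : measurable_fun setT f -> g \in Lfun P 1 ->
  (forall w, `|f w| <= g w) -> f \in Lfun P 1.
Proof.
move=> mf /Lfun1_integrable ig fg; apply/Lfun1_integrable.
apply: le_integrable ig => //; first exact/measurable_EFinP.
by move=> w _ /=; rewrite lee_fin (le_trans (fg w))// ler_norm.
Qed.

(** Converse of [Lfun2_integrable_sqr]. *)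
Lemma Lfun2P f : measurable_fun setT f -> (fun w => f w ^+ 2) \in Lfun P 1 ->
  f \in Lfun P 2%:E.
Proof.
move=> mf /Lfun1_integrable/integrableP[_ i2].
rewrite inE; apply/andP; split; rewrite inE//=.
rewrite /finite_norm unlock/= poweR_lty//.
apply: le_lt_trans i2; rewrite le_eqVlt; apply/orP; left; apply/eqP.
by apply: eq_integral => w _ /=; rewrite powR_mulrn// normrX.
Qed.

Lemma Lfun2_sqr f : f \in Lfun P 2%:E -> (fun w => f w ^+ 2) \in Lfun P 1.
Proof. by move/Lfun2_integrable_sqr => ?; exact/Lfun1_integrable. Qed.

Lemma Lfun21 f : f \in Lfun P 2%:E -> f \in Lfun P 1.
Proof. by apply: Lfun_subset12; rewrite fin_num_measure. Qed.

Lemma Lfun2M f g : f \in Lfun P 2%:E -> g \in Lfun P 2%:E ->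
  (fun w => f w * g w) \in Lfun P 1.
Proof. exact: Lfun2_mul_Lfun1. Qed.

Lemma Lfun2_dom f g : measurable_fun setT f -> g \in Lfun P 2%:E ->
  (forall w, `|f w| <= `|g w|) -> f \in Lfun P 2%:E.
Proof.
move=> mf /Lfun2_sqr g2 fg; apply: Lfun2P => //.
apply: (Lfun1_dom _ g2); first exact: measurable_funX.
by move=> w; rewrite normrX -(real_normK (num_real (g w))) lerXn2r ?nnegrE.
Qed.

Lemma LfunD r f g : 1 <= r -> f \in Lfun P r%:E -> g \in Lfun P r%:E ->
  (fun w => f w + g w) \in Lfun P r%:E.
Proof. by move=> r1 f1 g1; rewrite (_ : (fun _ => _) = f + g)// rpredD. Qed.

Lemma LfunB r f g : 1 <= r -> f \in Lfun P r%:E -> g \in Lfun P r%:E ->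
  (fun w => f w - g w) \in Lfun P r%:E.
Proof. by move=> r1 f1 g1; rewrite (_ : (fun _ => _) = f - g)// rpredB. Qed.

Lemma LfunZ r c f : 1 <= r -> f \in Lfun P r%:E ->
  (fun w => c * f w) \in Lfun P r%:E.
Proof.
move=> r1 fr; have := Lfun_scale c r1 fr.
by rewrite (_ : (c \o* f) = (fun w => c * f w))//; apply/funext => w /=; rewrite mulrC.
Qed.

Lemma Lfun_sum r (I : Type) (s : seq I) (Q : pred I) (F : I -> T -> R) : 1 <= r ->
  (forall i, F i \in Lfun P r%:E) ->
  (fun w => \sum_(i <- s | Q i) F i w) \in Lfun P r%:E.
Proof.
move=> r1 Fr; elim: s => [|i s ih].
  under eq_fun do rewrite big_nil.
  exact: Lfun_cst.
under eq_fun do rewrite big_cons.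
by case: (Q i) => //; apply: LfunD.
Qed.

Lemma Lfun_bounded r f c : 1 <= r -> measurable_fun setT f ->
  (forall w, `|f w| <= c) -> f \in Lfun P r%:E.
Proof.
move=> r1 mf fc.
rewrite inE; apply/andP; split; rewrite inE//=.
rewrite /finite_norm unlock/= poweR_lty//.
apply: (@le_lt_trans _ _ (\int[P]_w (c `^ r)%:E)%E).
  apply: ge0_le_integral => //=.
  - apply/measurable_EFinP; apply: (measurableT_comp (measurable_powR _)).
    exact: measurableT_comp.
  - move=> w _; rewrite lee_fin ge0_ler_powR ?nnegrE//; first by rewrite (le_trans _ r1).
    exact: le_trans (fc w).
by rewrite integral_cst//= probability_setT mule1 ltry.
Qed.

Definition mean f : R := \int[P]_w f w.

Lemma expectation_mean f : f \in Lfun P 1 -> ('E_P[f] = (mean f)%:E)%E.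
Proof.
by move=> f1; rewrite /mean /Rintegral -(fineK (expectation_fin_num f1)) unlock.
Qed.

Lemma meanD f g : f \in Lfun P 1 -> g \in Lfun P 1 ->
  mean (fun w => f w + g w) = mean f + mean g.
Proof. by move=> f1 g1; apply: RintegralD => //; exact/Lfun1_integrable. Qed.

Lemma meanB f g : f \in Lfun P 1 -> g \in Lfun P 1 ->
  mean (fun w => f w - g w) = mean f - mean g.
Proof. by move=> f1 g1; apply: RintegralB => //; exact/Lfun1_integrable. Qed.

Lemma meanZ c f : f \in Lfun P 1 -> mean (fun w => c * f w) = c * mean f.
Proof. by move=> f1; apply: RintegralZl => //; exact/Lfun1_integrable. Qed.

Lemma mean_cst c : mean (fun=> c) = c.
Proof. by rewrite /mean Rintegral_cst //=; rewrite probability_setT mulr1. Qed.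

Lemma mean_ge0 f : (forall w, 0 <= f w) -> 0 <= mean f.
Proof. by move=> f0; apply: Rintegral_ge0. Qed.

Lemma eq_mean f g : f =1 g -> mean f = mean g.
Proof. by move=> fg; congr mean; exact/funext. Qed.

Lemma mean_sum (n : nat) (F : nat -> T -> R) : (forall i, F i \in Lfun P 1) ->
  mean (fun w => \sum_(i < n) F i w) = \sum_(i < n) mean (F i).
Proof.
move=> F1; elim: n => [|n ih].
  by rewrite big_ord0 (@eq_mean _ (fun=> 0)) ?mean_cst// => w; rewrite big_ord0.
rewrite (@eq_mean _ (fun w => \sum_(i < n) F i w + F n w)); last first.
  by move=> w; rewrite big_ord_recr.
by rewrite meanD ?Lfun_sum// ih big_ord_recr.
Qed.

Lemma le_mean f g : f \in Lfun P 1 -> g \in Lfun P 1 ->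
  (forall w, f w <= g w) -> mean f <= mean g.
Proof. by move=> f1 g1 fg; apply: le_Rintegral => //; exact/Lfun1_integrable. Qed.

Lemma norm_mean_le f g : f \in Lfun P 1 -> g \in Lfun P 1 ->
  (forall w, `|f w| <= g w) -> `|mean f| <= mean g.
Proof.
move=> f1 g1 fg; apply: (le_trans (le_normr_Rintegral _ _)) => //.
  exact/Lfun1_integrable.
by apply: le_mean => //; exact: Lfun_norm.
Qed.

Lemma sqr_mean_le f : f \in Lfun P 2%:E -> mean f ^+ 2 <= mean (fun w => f w ^+ 2).
Proof.
move=> f2; have f1 := Lfun21 f2; have ff1 := Lfun2_sqr f2.
have : 0 <= mean (fun w => (f w - mean f) ^+ 2) by apply: mean_ge0 => w; exact: sqr_ge0.
rewrite (@eq_mean _ (fun w => f w ^+ 2 - (2 * mean f * f w - mean f ^+ 2))); last first.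
  by move=> w; ring.
rewrite meanB//; last by rewrite LfunB ?LfunZ ?Lfun_cst.
rewrite meanB ?LfunZ ?Lfun_cst// meanZ// mean_cst.
by lra.
Qed.

(** The Cauchy-Schwarz inequality against the constant 1. *)
Lemma mean_norm_le f : f \in Lfun P 2%:E ->
  mean (fun w => `|f w|) <= Num.sqrt (mean (fun w => f w ^+ 2)).
Proof.
move=> f2; have n2 : (fun w => `|f w|) \in Lfun P 2%:E.
  apply: (Lfun2_dom _ f2); first exact/measurableT_comp/(Lfun_measurable f2).
  by move=> w; rewrite normr_id.
rewrite -(@ger0_norm _ (mean _)) ?mean_ge0// -sqrtr_sqr ler_wsqrtr//.
apply: le_trans (sqr_mean_le n2) _.
by rewrite le_eqVlt; apply/orP; left; apply/eqP/eq_mean => w; rewrite real_normK ?num_real.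
Qed.

Definition cov f g : R := mean (fun w => f w * g w) - mean f * mean g.

Lemma covariance_cov f g : f \in Lfun P 2%:E -> g \in Lfun P 2%:E ->
  covariance P f g = (cov f g)%:E.
Proof.
move=> f2 g2; have f1 := Lfun21 f2; have g1 := Lfun21 g2; have fg1 := Lfun2M f2 g2.
rewrite (covarianceE f1 g1 fg1).
by rewrite (expectation_mean f1) (expectation_mean g1) (expectation_mean fg1).
Qed.

Lemma covC f g : cov f g = cov g f.
Proof. by rewrite /cov mulrC; congr (_ - _); apply: eq_mean => w; rewrite mulrC. Qed.

Lemma covDl f g h : f \in Lfun P 2%:E -> g \in Lfun P 2%:E -> h \in Lfun P 2%:E ->
  cov (fun w => f w + g w) h = cov f h + cov g h.
Proof.
move=> f2 g2 h2; rewrite /cov meanD ?Lfun21//.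
rewrite (@eq_mean _ (fun w => f w * h w + g w * h w)); last by move=> w; rewrite mulrDl.
by rewrite meanD ?Lfun2M//; ring.
Qed.

Lemma covZl c f h : f \in Lfun P 2%:E -> h \in Lfun P 2%:E ->
  cov (fun w => c * f w) h = c * cov f h.
Proof.
move=> f2 h2; rewrite /cov meanZ ?Lfun21//.
rewrite (@eq_mean _ (fun w => c * (f w * h w))); last by move=> w; rewrite mulrA.
by rewrite meanZ ?Lfun2M//; ring.
Qed.

Lemma covBl f g h : f \in Lfun P 2%:E -> g \in Lfun P 2%:E -> h \in Lfun P 2%:E ->
  cov (fun w => f w - g w) h = cov f h - cov g h.
Proof.
move=> f2 g2 h2; rewrite -mulN1r -covZl// -covDl ?LfunZ ?ler1n//.
by congr cov; apply/funext => w; rewrite mulN1r.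
Qed.

Lemma covDr f g h : f \in Lfun P 2%:E -> g \in Lfun P 2%:E -> h \in Lfun P 2%:E ->
  cov h (fun w => f w + g w) = cov h f + cov h g.
Proof. by move=> ? ? ?; rewrite covC covDl// !(covC h). Qed.

Lemma covBr f g h : f \in Lfun P 2%:E -> g \in Lfun P 2%:E -> h \in Lfun P 2%:E ->
  cov h (fun w => f w - g w) = cov h f - cov h g.
Proof. by move=> ? ? ?; rewrite covC covBl// !(covC h). Qed.

Lemma covZr c f h : f \in Lfun P 2%:E -> h \in Lfun P 2%:E ->
  cov h (fun w => c * f w) = c * cov h f.
Proof. by move=> ? ?; rewrite covC covZl// (covC h). Qed.

End Mean.

(** * The covariance inequality for associated pairs *)

Section PairAssociation.
Context d (T : measurableType d) (R : realType) (P : probability T R).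

(** The part of association that the replacement argument uses.  It concerns two
    real variables only, so that it applies to sums of blocks without reference
    to the sequence they come from. *)
Definition pair_associated (U V : T -> R) := forall F G : R -> R,
  {homo F : x y / x <= y} -> {homo G : x y / x <= y} ->
  F \o U \in Lfun P 2%:E -> G \o V \in Lfun P 2%:E -> 0 <= cov P (F \o U) (G \o V).

Definition lipschitz_with (A : R) (F : R -> R) := forall x y, `|F x - F y| <= A * `|x - y|.

Lemma lipschitz_with_continuous A F : lipschitz_with A F -> continuous F.
Proof.
move=> lF x; apply/cvgrPdist_le => e e0.
have A0 : 0 <= A by have := lF 1 0; rewrite subr0 normr1 mulr1; exact: le_trans.
have A1 : 0 < A + 1 by rewrite ltr_wpDl.
near=> y.
apply: le_trans (lF _ _) _.
apply: (@le_trans _ _ ((A + 1) * `|x - y|)).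
  by rewrite ler_wpM2r// lerDl.
rewrite mulrC -ler_pdivlMr//.
near: y; have /cvgrPdist_le := @cvg_id _ (nbhs x); apply; exact: divr_gt0.
Unshelve. all: by end_near. Qed.

Lemma lipschitz_with_Lfun2 A F (U : T -> R) : lipschitz_with A F ->
  U \in Lfun P 2%:E -> F \o U \in Lfun P 2%:E.
Proof.
move=> lF U2.
have nU2 : (fun w => `|F 0| + A * `|U w|) \in Lfun P 2%:E.
  apply: LfunD; rewrite ?ler1n ?Lfun_cst//; apply: LfunZ; rewrite ?ler1n//.
  apply: (Lfun2_dom _ U2); first exact/measurableT_comp/(Lfun_measurable U2).
  by move=> w; rewrite normr_id.
apply: (Lfun2_dom _ nU2).
  apply: measurableT_comp (Lfun_measurable U2).
  by have := lipschitz_with_continuous lF; exact: continuous_measurable_fun.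
move=> w /=; apply: le_trans (ler_norm _).
rewrite -[X in `|X|](subrK (F 0)) addrC; apply: le_trans (ler_normD _ _) _.
by rewrite lerD2l (le_trans (lF _ _))// subr0.
Qed.

(** If [F] is [A]-Lipschitz then [A x + F x] and [A x - F x] are nondecreasing.
    Expanding the four nonnegative covariances of these functions of [U] with the
    analogous functions of [V] and adding them in pairs gives both inequalities. *)
Lemma cov_lipschitz_le (U V : T -> R) A B (F G : R -> R) :
  U \in Lfun P 2%:E -> V \in Lfun P 2%:E -> pair_associated U V ->
  lipschitz_with A F -> lipschitz_with B G ->
  `|cov P (F \o U) (G \o V)| <= A * B * cov P U V.
Proof.
move=> U2 V2 UV lF lG.
have FU2 := lipschitz_with_Lfun2 lF U2.
have GV2 := lipschitz_with_Lfun2 lG V2.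
have monoD C K : lipschitz_with C K -> {homo (fun x => C * x + K x) : x y / x <= y}.
  move=> lK x y xy; have := lK x y; rewrite distrC [`|x - y|]distrC.
  by rewrite (ger0_norm (_ : 0 <= y - x)) ?subr_ge0// ler_norml => /andP[]; lra.
have monoB C K : lipschitz_with C K -> {homo (fun x => C * x - K x) : x y / x <= y}.
  move=> lK x y xy; have := lK x y; rewrite distrC [`|x - y|]distrC.
  by rewrite (ger0_norm (_ : 0 <= y - x)) ?subr_ge0// ler_norml => /andP[]; lra.
have AU2 : (fun w => A * U w) \in Lfun P 2%:E by rewrite LfunZ ?ler1n.
have BV2 : (fun w => B * V w) \in Lfun P 2%:E by rewrite LfunZ ?ler1n.
have LD (f g : T -> R) : f \in Lfun P 2%:E -> g \in Lfun P 2%:E ->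
  (fun w => f w + g w) \in Lfun P 2%:E by move=> ? ?; rewrite LfunD ?ler1n.
have LB (f g : T -> R) : f \in Lfun P 2%:E -> g \in Lfun P 2%:E ->
  (fun w => f w - g w) \in Lfun P 2%:E by move=> ? ?; rewrite LfunB ?ler1n.
have BVp := LD _ _ BV2 GV2; have BVm := LB _ _ BV2 GV2.
have pp := UV _ _ (monoD _ _ lF) (monoD _ _ lG) (LD _ _ AU2 FU2) BVp.
have pm := UV _ _ (monoD _ _ lF) (monoB _ _ lG) (LD _ _ AU2 FU2) BVm.
have mp := UV _ _ (monoB _ _ lF) (monoD _ _ lG) (LB _ _ AU2 FU2) BVp.
have mm := UV _ _ (monoB _ _ lF) (monoB _ _ lG) (LB _ _ AU2 FU2) BVm.
move: pp pm mp mm.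
rewrite (covDl AU2 FU2 BVp) (covDl AU2 FU2 BVm) (covBl AU2 FU2 BVp) (covBl AU2 FU2 BVm).
rewrite (covDr BV2 GV2 AU2) (covDr BV2 GV2 FU2) (covBr BV2 GV2 AU2) (covBr BV2 GV2 FU2).
rewrite (covZl _ U2 BV2) (covZl _ U2 GV2) (covZr _ V2 U2) (covZr _ V2 FU2).
by move=> pp pm mp mm; rewrite ler_norml; apply/andP; split; lra.
Qed.

End PairAssociation.

(** * Replacing one block by a Gaussian *)

Section LindebergStep.
Context d (T : measurableType d) (R : realType) (P : probability T R).

Lemma cubic_cut_ge0 (y : R) : 0 <= cubic_cut y.
Proof. by rewrite le_min sqr_ge0 exprn_ge0. Qed.

Lemma measurable_cubic_cut : measurable_fun setT (@cubic_cut R).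
Proof.
by apply: measurable_minr; apply: measurable_funX => //; exact: measurable_id.
Qed.

Lemma cubic_cut_Lfun1 (V : T -> R) : V \in Lfun P 2%:E ->
  (fun w => cubic_cut (V w)) \in Lfun P 1.
Proof.
move=> V2; apply: (Lfun1_dom _ (Lfun2_sqr V2)).
  exact: measurableT_comp measurable_cubic_cut (Lfun_measurable V2).
by move=> w; rewrite ger0_norm ?cubic_cut_ge0// ge_min lexx.
Qed.

(** Squares are not Lipschitz, but truncated squares are; what the truncation
    removes is at most [cubic_cut]. *)
Lemma lipschitz_sqr_cut : lipschitz_with 2 (fun y : R => Num.min (y ^+ 2) 1).
Proof.
have half (a b : R) : `|b| <= `|a| -> `|Num.min (a ^+ 2) 1 - Num.min (b ^+ 2) 1| <= 2 * `|a - b|.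
  move=> ba.
  have b2a2 : b ^+ 2 <= a ^+ 2 by rewrite -real_normK ?num_real// -[leRHS]real_normK ?num_real// lerXn2r ?nnegrE.
  have hab : `|a| - `|b| <= `|a - b| by apply: lerB_dist.
  have [a1|a1] := leP `|a| 1.
    have ale1 : a ^+ 2 <= 1 by rewrite -real_normK ?num_real// expr_le1.
    rewrite !(min_idPl _) ?(le_trans b2a2)// subr_sqr normrM mulrC ler_wpM2r//.
    by rewrite (le_trans (ler_normD _ _))//; have := le_trans ba a1; lra.
  have a21 : 1 <= a ^+ 2 by rewrite -real_normK ?num_real// expr_ge1// ltW.
  rewrite [Num.min (a ^+ 2) 1]min_r//.
  have [b1|b1] := leP `|b| 1; last first.
    rewrite min_r ?subrr ?normr0 ?mulr_ge0//.
    by rewrite -real_normK ?num_real// expr_ge1// ltW.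
  have b21 : b ^+ 2 <= 1 by rewrite -real_normK ?num_real// expr_le1.
  rewrite min_l// ger0_norm ?subr_ge0//.
  by have := normr_ge0 b; rewrite -(@real_normK _ b) ?num_real//; nra.
move=> x y; have [xy|/ltW yx] := leP `|x| `|y|; last exact: half.
by rewrite distrC [`|x - y|]distrC; exact: half.
Qed.

Let sum_of_errors_le (a b e x y z q w k : R) : `|a| <= q -> `|b| <= w -> `|e| <= k ->
  `|x| <= 2 * k -> `|y| <= q -> `|z| <= q ->
  `|a + e - b + 2^-1 * x + 2^-1 * (y - z)| <= 2 * k + 2 * q + 2 * w.
Proof.
move=> aq bw ek xk yq zq; have w0 : 0 <= w by exact: le_trans bw.
move: aq bw ek xk yq zq; rewrite !ler_norml.
move=> /andP[? ?] /andP[? ?] /andP[? ?] /andP[? ?] /andP[? ?] /andP[? ?].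
by apply/andP; split; lra.
Qed.

Let regroup (p q g e h k x y z : R) : p - q =
  p - g - e - 2^-1 * (h + k) + e - (q - g - (x + y) / 2 * z) +
  2^-1 * (h - z * x) + 2^-1 * (k - z * y).
Proof. by field. Qed.

Variables (U V : T -> R) (t0 t C a : R).
Hypotheses (U2 : U \in Lfun P 2%:E) (V2 : V \in Lfun P 2%:E).
Hypotheses (V0 : mean P V = 0) (UV : pair_associated P U V).
Hypotheses (gC : @gauss_regular R t0 C) (t0t : t0 <= t).
Let v := mean P (fun w => V w ^+ 2).

(** The difference is split into the two Taylor remainders, the covariance of
    [gauss1 t (U - a)] with [V], and the covariance of [gauss2 t (U - a)] with
    [V^2].  In the last one [V^2] is the sum of its truncation at 1, handled by
    the covariance inequality, and of a rest handled by its mean. *)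
Lemma lindeberg_step :
  `|mean P (fun w => gauss t (U w + V w - a)) - mean P (fun w => gauss (t + v) (U w - a))|
  <= 2 * C * (cov P U V + mean P (fun w => cubic_cut (V w)) + v ^+ 2).
Proof.
have [[taylor heat lip1 lip2 b2] [lip0 _]] := gC t0t.
have v0 : 0 <= v by apply: mean_ge0 => w; exact: sqr_ge0.
have t0tv : t0 <= t + v by rewrite (le_trans t0t)// lerDl.
have [_ [lip0v _]] := gC t0tv.
have C0 : 0 <= C by apply: le_trans (b2 0).
have ge12 : 1 <= 2 :> R by rewrite ler1n.
pose psi w := cubic_cut (V w).
have psi1 : psi \in Lfun P 1 by exact: cubic_cut_Lfun1.
pose F1 x := gauss1 t (x - a).
pose F2 x := gauss2 t (x - a).
have lF1 : lipschitz_with C F1.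
  by move=> x y; apply: le_trans (lip1 _ _) _; rewrite opprB addrA subrK.
have lF2 : lipschitz_with C F2.
  by move=> x y; apply: le_trans (lip2 _ _) _; rewrite opprB addrA subrK.
have lid : lipschitz_with 1 (@id R) by move=> x y; rewrite mul1r.
have UVL2 : (fun w => U w + V w) \in Lfun P 2%:E by rewrite LfunD.
have lshift s : (forall x y, `|gauss s x - gauss s y| <= C * `|x - y|) ->
    lipschitz_with C (fun x => gauss s (x - a)).
  by move=> ls x y; apply: le_trans (ls _ _) _; rewrite opprB addrA subrK.
pose g w := gauss t (U w - a).
pose gv w := gauss (t + v) (U w - a).
pose gp w := gauss t (U w + V w - a).
have gL : g \in Lfun P 2%:E by exact: (lipschitz_with_Lfun2 (lshift _ lip0) U2).
have gvL : gv \in Lfun P 2%:E by exact: (lipschitz_with_Lfun2 (lshift _ lip0v) U2).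
have gpL : gp \in Lfun P 2%:E by exact: (lipschitz_with_Lfun2 (lshift _ lip0) UVL2).
pose f1 w := F1 (U w); pose f2 w := F2 (U w).
have f1L : f1 \in Lfun P 2%:E by exact: (lipschitz_with_Lfun2 lF1 U2).
have f2L : f2 \in Lfun P 2%:E by exact: (lipschitz_with_Lfun2 lF2 U2).
pose c w := Num.min (V w ^+ 2) 1.
have cL : c \in Lfun P 2%:E by exact: (lipschitz_with_Lfun2 lipschitz_sqr_cut V2).
pose rho w := V w ^+ 2 - c w.
have VV1 := Lfun2_sqr V2.
have rho1 : rho \in Lfun P 1 by rewrite LfunB// Lfun21.
have rho_ge0 w : 0 <= rho w by rewrite subr_ge0 ge_min lexx.
have rho_psi w : rho w <= psi w.
  rewrite /rho /c /psi /cubic_cut; have [h|h] := leP (V w ^+ 2) 1.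
    by rewrite subrr cubic_cut_ge0.
  rewrite le_min; apply/andP; split; first by rewrite lerBlDr lerDl.
  have V1 : 1 < `|V w|.
    by rewrite -(@expr_gt1 _ 2)// real_normK ?num_real.
  rewrite [leRHS]exprSr real_normK ?num_real//.
  apply: (@le_trans _ _ (V w ^+ 2)); first by rewrite lerBlDr lerDl.
  by rewrite ler_peMr ?sqr_ge0// ltW.
have f2b w : `|f2 w| <= C by exact: b2.
have f2rho1 : (fun w => f2 w * rho w) \in Lfun P 1.
  have Crho : (fun w => C * rho w) \in Lfun P 1 by rewrite LfunZ.
  apply: (Lfun1_dom _ Crho).
    by apply: measurable_funM; [exact: Lfun_measurable f2L|exact: Lfun_measurable rho1].
  by move=> w; rewrite normrM (ger0_norm (rho_ge0 w)) ler_wpM2r.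
pose R1 w := gp w - g w - f1 w * V w - f2 w * V w ^+ 2 / 2.
pose R2 w := gv w - g w - v / 2 * f2 w.
have f2VV w : f2 w * V w ^+ 2 / 2 = 2^-1 * (f2 w * c w + f2 w * rho w).
  by rewrite /rho; field.
have f2VV1 : (fun w => f2 w * V w ^+ 2 / 2) \in Lfun P 1.
  rewrite (_ : (fun _ => _) = (fun w => 2^-1 * (f2 w * c w + f2 w * rho w))); last exact/funext.
  by rewrite LfunZ// LfunD// Lfun2M.
have R1b w : `|R1 w| <= C * psi w.
  have := taylor (U w - a) (V w).
  by rewrite [U w - a + V w]addrAC.
have R2b w : `|R2 w| <= C * v ^+ 2 by exact: heat.
have f1V1 : (fun w => f1 w * V w) \in Lfun P 1 by exact: Lfun2M.
have L1B (f h : T -> R) : f \in Lfun P 1 -> h \in Lfun P 1 -> (fun w => f w - h w) \in Lfun P 1.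
  by move=> ? ?; rewrite LfunB.
have gp1 := Lfun21 gpL; have g1 := Lfun21 gL; have gv1 := Lfun21 gvL; have f21 := Lfun21 f2L.
have vf21 : (fun w => v / 2 * f2 w) \in Lfun P 1 by rewrite LfunZ.
have R1L : R1 \in Lfun P 1 by exact: (L1B _ _ (L1B _ _ (L1B _ _ gp1 g1) f1V1) f2VV1).
have R2L : R2 \in Lfun P 1 by exact: (L1B _ _ (L1B _ _ gv1 g1) vf21).
have mR1 : mean P R1 = mean P gp - mean P g - mean P (fun w => f1 w * V w)
    - 2^-1 * (mean P (fun w => f2 w * c w) + mean P (fun w => f2 w * rho w)).
  rewrite /R1 (meanB (L1B _ _ (L1B _ _ gp1 g1) f1V1) f2VV1) (meanB (L1B _ _ gp1 g1) f1V1).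
  rewrite (meanB gp1 g1); congr (_ - _).
  have f2c1 := Lfun2M f2L cL.
  rewrite (eq_mean P f2VV) meanZ; last by rewrite LfunD.
  by rewrite meanD.
have mR2 : mean P R2 = mean P gv - mean P g - v / 2 * mean P f2.
  by rewrite /R2 (meanB (L1B _ _ gv1 g1) vf21) (meanB gv1 g1) (meanZ _ f21).
have vE : v = mean P c + mean P rho.
  rewrite /rho (meanB VV1 (Lfun21 cL)); rewrite -/v; ring.
have b1 : `|mean P R1| <= C * mean P psi.
  by rewrite -meanZ//; apply: norm_mean_le => //; rewrite LfunZ.
have b2' : `|mean P R2| <= C * v ^+ 2.
  by rewrite -[leRHS](mean_cst P); apply: norm_mean_le => //; rewrite Lfun_cst.
have c1 : `|mean P (fun w => f1 w * V w)| <= C * cov P U V.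
  have := cov_lipschitz_le U2 V2 UV lF1 lid.
  have e1 : mean P (id \o V) = 0 by exact: V0.
  by rewrite {1}/cov e1 mulr0 subr0 mulr1.
have c2 : `|mean P (fun w => f2 w * c w) - mean P f2 * mean P c| <= 2 * C * cov P U V.
  have := cov_lipschitz_le U2 V2 UV lF2 lipschitz_sqr_cut.
  by rewrite (mulrC C 2).
have rho_psi_mean : mean P rho <= mean P psi by exact: le_mean.
have c3 : `|mean P (fun w => f2 w * rho w)| <= C * mean P psi.
  apply: (@le_trans _ _ (mean P (fun w => C * rho w))).
    apply: norm_mean_le => //; first by rewrite LfunZ.
    by move=> w; rewrite normrM (ger0_norm (rho_ge0 w)) ler_wpM2r.
  by rewrite meanZ// ler_wpM2l.
have c4 : `|mean P f2 * mean P rho| <= C * mean P psi.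
  rewrite normrM; apply: ler_pM => //.
    by rewrite -[leRHS](mean_cst P); apply: norm_mean_le => //; rewrite Lfun_cst.
  by rewrite ger0_norm ?mean_ge0.
rewrite -/gp -/gv.
have -> : mean P gp - mean P gv = mean P R1 + mean P (fun w => f1 w * V w) - mean P R2
  + 2^-1 * (mean P (fun w => f2 w * c w) - mean P f2 * mean P c)
  + 2^-1 * (mean P (fun w => f2 w * rho w) - mean P f2 * mean P rho).
  rewrite mR1 mR2 vE; exact: regroup.
rewrite -mulrA in c2.
apply: le_trans (sum_of_errors_le b1 b2' c1 c2 c3 c4) _.
by rewrite -/psi -mulrA !mulrDr.
Qed.

End LindebergStep.

(** * Replacing all the blocks *)

Section Telescoping.
Context d (T : measurableType d) (R : realType) (P : probability T R).
Variables (Y : nat -> T -> R) (t0 C a : R).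
Let S j w := \sum_(i < j) Y i w.
Let v j := mean P (fun w => Y j w ^+ 2).
Let psi j := mean P (fun w => cubic_cut (Y j w)).
Hypotheses (Y2 : forall j, Y j \in Lfun P 2%:E) (Y0 : forall j, mean P (Y j) = 0).
Hypothesis SY : forall j, pair_associated P (S j) (Y j).
Hypothesis gC : @gauss_regular R t0 C.

Let S2 j : S j \in Lfun P 2%:E.
Proof. by rewrite Lfun_sum// ler1n. Qed.

Let SS j w : S j.+1 w = S j w + Y j w.
Proof. by rewrite /S big_ord_recr. Qed.

Let v_ge0 j : 0 <= v j.
Proof. by apply: mean_ge0 => w; exact: sqr_ge0. Qed.

Let sum_cov m : \sum_(j < m) cov P (S j) (Y j) * 2 =
  mean P (fun w => S m w ^+ 2) - \sum_(j < m) v j.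
Proof.
elim: m => [|m ih].
  rewrite !big_ord0 subr0 (@eq_mean _ _ _ _ _ (fun=> 0)) ?mean_cst// => w.
  by rewrite /S big_ord0 expr0n.
rewrite !big_ord_recr/= ih.
have -> : mean P (fun w => S m.+1 w ^+ 2) =
    mean P (fun w => S m w ^+ 2) + mean P (fun w => 2 * (S m w * Y m w)) + v m.
  rewrite -meanD ?Lfun2_sqr ?LfunZ ?Lfun2M// -meanD ?Lfun2_sqr//; last first.
    by rewrite LfunD ?Lfun2_sqr ?LfunZ ?Lfun2M.
  by apply: eq_mean => w; rewrite SS; ring.
by rewrite meanZ ?Lfun2M// /cov Y0; ring.
Qed.

(** One replacement per block, from the last to the first: the variance of the
    bump collects the variances of the blocks already replaced.  The covariances
    telescope because [Var(S + Y) = Var(S) + Var(Y) + 2 Cov(S, Y)]. *)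
Lemma lindeberg_sum m t : t0 <= t ->
  `|mean P (fun w => gauss t (S m w - a)) - gauss (t + \sum_(j < m) v j) (- a)| <=
  2 * C * (mean P (fun w => S m w ^+ 2) - \sum_(j < m) v j
           + \sum_(j < m) psi j + \sum_(j < m) v j ^+ 2).
Proof.
have C0 : t0 <= t -> 0 <= C by move=> /gC[[_ _ _ _ b2] _]; apply: le_trans (b2 0).
move=> t0t; have {}C0 := C0 t0t.
have cov_ge0 j : 0 <= cov P (S j) (Y j).
  exact: (@SY j id id (fun _ _ => id) (fun _ _ => id) (S2 j) (Y2 j)).
apply: (@le_trans _ _ (2 * C * \sum_(j < m) (cov P (S j) (Y j) + psi j + v j ^+ 2))); last first.
  rewrite ler_wpM2l ?mulr_ge0// -sum_cov big_split big_split/= !lerD2r.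
  by apply: ler_sum => j _; rewrite ler_peMr// ler1n.
elim: m t t0t => [|m ih] t t0t.
  rewrite !big_ord0 addr0 mulr0 (@eq_mean _ _ _ _ _ (fun=> gauss t (- a))).
    by rewrite mean_cst subrr normr0.
  by move=> w; rewrite /S big_ord0 sub0r.
rewrite !big_ord_recr/= mulrDr.
have t0tv : t0 <= t + v m by rewrite (le_trans t0t)// lerDl.
have := ih _ t0tv; rewrite (_ : t + v m + _ = t + (\sum_(j < m) v j + v m)); last first.
  by rewrite -addrA [v m + _]addrC.
move=> {}ih.
have := lindeberg_step a (S2 m) (Y2 m) (Y0 m) (@SY m) gC t0t => step.
rewrite [leRHS]addrC; apply: le_trans (ler_distD (mean P (fun w => gauss (t + v m) (S m w - a))) _ _) _.
apply: lerD => //.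
rewrite (@eq_mean _ _ _ P _ (fun w => gauss t (S m w + Y m w - a)))//.
by move=> w; rewrite SS.
Qed.

End Telescoping.

(** * Blocks of an associated sequence *)

Section Blocks.
Context d (T : measurableType d) (R : realType) (P : probability T R).
Variable X : nat -> {RV P >-> R}.
Hypotheses (X_assoc : associated X) (X2 : forall i, (X i : T -> R) \in Lfun P 2%:E).
Hypothesis X0 : forall i, mean P (X i) = 0.
Local Notation S := (partial_sum X).

Lemma partial_sum_Lfun2 n : S n \in Lfun P 2%:E.
Proof. by rewrite /partial_sum Lfun_sum// ler1n. Qed.

Lemma increment_Lfun2 n k : (fun w => S n w - S k w) \in Lfun P 2%:E.
Proof. by rewrite LfunB ?ler1n// partial_sum_Lfun2. Qed.

Lemma mean_partial_sum n : mean P (S n) = 0.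
Proof.
elim: n => [|n ih].
  by rewrite (@eq_mean _ _ _ _ _ (fun=> 0)) ?mean_cst// => w; rewrite /partial_sum big_ord0.
rewrite (@eq_mean _ _ _ _ _ (fun w => S n w + X n w)); last first.
  by move=> w; rewrite /partial_sum big_ord_recr.
by rewrite meanD ?Lfun21 ?partial_sum_Lfun2// ih X0 addr0.
Qed.

Lemma partial_sum_increment (k n : nat) w : (k <= n)%N ->
  S n w - S k w = \sum_(i < n | (k <= i)%N) X i w.
Proof.
move=> kn; rewrite /partial_sum (bigID (fun i : 'I_n => (i < k)%N))/=.
rewrite [X in X + _ - _](_ : _ = \sum_(i < k) X i w); last first.
  by rewrite (big_ord_widen_cond n predT (fun i => X i w)).
by rewrite addrC addKr; apply: eq_bigl => i; rewrite -leqNgt.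
Qed.

(** [S_k] and [S_n - S_k] are nondecreasing functions of [(X_1, ..., X_n)]: they
    are sums over complementary sets of indices. *)
Lemma pair_associated_increment (k n : nat) (c : R) : (k <= n)%N -> 0 <= c ->
  pair_associated P (fun w => c * S k w) (fun w => c * (S n w - S k w)).
Proof.
move=> kn c0 F G mF mG FU GV.
(* Both functions are extended to the first [n] coordinates. *)
pose h (x : n.-tuple R) := F (c * \sum_(i < n | (i < k)%N) tnth x i).
pose g (x : n.-tuple R) := G (c * \sum_(i < n | (k <= i)%N) tnth x i).
pose Z := subvector X (fun i : 'I_n => i : nat).
have hZ : h \o Z = F \o (fun w => c * S k w).
  apply/funext => w; rewrite /h /Z /=; congr (F (c * _)).
  under eq_bigr do rewrite tnth_mktuple.
  by rewrite /partial_sum (big_ord_widen_cond n predT (fun i => X i w)).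
have gZ : g \o Z = G \o (fun w => c * (S n w - S k w)).
  apply/funext => w; rewrite /g /Z /=; congr (G (c * _)).
  under eq_bigr do rewrite tnth_mktuple.
  by rewrite partial_sum_increment.
have mono (K : R -> R) (Q : pred 'I_n) : {homo K : x y / x <= y} ->
    coordinatewise_nondecreasing (fun x : n.-tuple R => K (c * \sum_(i < n | Q i) tnth x i)).
  by move=> mK x y xy; apply: mK; rewrite ler_wpM2l// ler_sum.
rewrite -lee_fin -covariance_cov//.
rewrite -hZ -gZ; apply: (X_assoc (@ord_inj n)).
- exact: mono.
- exact: mono.
- by rewrite hZ Lfun21.
- by rewrite gZ Lfun21.
- have := Lfun2M FU GV; rewrite -hZ -gZ; exact.
Qed.

Lemma cov_increment_ge0 k n : (k <= n)%N -> 0 <= cov P (S k) (fun w => S n w - S k w).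
Proof.
move=> kn; have := pair_associated_increment kn ler01.
rewrite (_ : (fun w => 1 * S k w) = S k); last by apply/funext => w; rewrite mul1r.
rewrite (_ : (fun w => 1 * _) = fun w => S n w - S k w); last by apply/funext => w; rewrite mul1r.
move=> h; apply: (h id id) => //; [exact: partial_sum_Lfun2|exact: increment_Lfun2].
Qed.

(** Association makes the cross term [2 Cov(S_k, S_n - S_k)] nonnegative. *)
Lemma mean_sqr_superadditive k n : (k <= n)%N ->
  mean P (fun w => S k w ^+ 2) + mean P (fun w => (S n w - S k w) ^+ 2) <=
  mean P (fun w => S n w ^+ 2).
Proof.
move=> kn; have := cov_increment_ge0 kn; rewrite /cov mean_partial_sum mul0r subr0 => c0.
have S2 := partial_sum_Lfun2; have I2 := increment_Lfun2.
rewrite [leRHS](@eq_mean _ _ _ _ _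
  (fun w => S k w ^+ 2 + (S n w - S k w) ^+ 2 + 2 * (S k w * (S n w - S k w)))); last first.
  by move=> w; ring.
have LM := Lfun2M (S2 k) (I2 n k).
have [l1 l2] := (Lfun2_sqr (S2 k), Lfun2_sqr (I2 n k)).
rewrite meanD//; [|by rewrite LfunD|by rewrite LfunZ].
by rewrite meanD// meanZ// lerDl mulr_ge0.
Qed.

Definition block (c : R) (l j : nat) (w : T) : R :=
  c * (S (j.+1 * l)%N w - S (j * l)%N w).

(** The main estimate.  The three summands of the bound account for the replacement
    of the complete blocks, for the difference between the sum of their variances
    and the target variance, and for the indices beyond the last block. *)
Lemma block_gauss_bound (t0 t C a s2 c : R) (l m n : nat) :
  gauss_regular t0 C -> t0 <= t -> 0 <= s2 -> 0 <= c -> (m * l <= n)%N ->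
  `|mean P (fun w => gauss t (c * S n w - a)) - gauss (t + s2) (- a)| <=
  2 * C * (mean P (fun w => (c * S (m * l)%N w) ^+ 2)
           - \sum_(j < m) mean P (fun w => block c l j w ^+ 2)
           + \sum_(j < m) mean P (fun w => cubic_cut (block c l j w))
           + \sum_(j < m) mean P (fun w => block c l j w ^+ 2) ^+ 2)
  + C * `|\sum_(j < m) mean P (fun w => block c l j w ^+ 2) - s2|
  + C * Num.sqrt (mean P (fun w => (c * (S n w - S (m * l)%N w)) ^+ 2)).
Proof.
move=> gC t0t s20 c0 mln.
pose Y := block c l; pose v j := mean P (fun w => Y j w ^+ 2).
have [[_ _ _ _ b2] [lip0 liptime]] := gC _ t0t.
have C0 : 0 <= C by apply: le_trans (b2 0).
have v_ge0 j : 0 <= v j by apply: mean_ge0 => w; exact: sqr_ge0.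
have ge12 : 1 <= 2 :> R by rewrite ler1n.
have Y2 j : Y j \in Lfun P 2%:E by rewrite LfunZ// increment_Lfun2.
have YS j w : \sum_(i < j) Y i w = c * S (j * l)%N w.
  elim: j => [|j ih]; first by rewrite big_ord0 mul0n /partial_sum big_ord0 mulr0.
  by rewrite big_ord_recr/= ih /Y /block -mulrDr addrC subrK.
have Y0 j : mean P (Y j) = 0.
  rewrite meanZ ?Lfun21 ?increment_Lfun2// meanB ?Lfun21 ?partial_sum_Lfun2//.
  by rewrite !mean_partial_sum subrr mulr0.
have SY j : pair_associated P (fun w => \sum_(i < j) Y i w) (Y j).
  rewrite (_ : (fun w => _) = fun w => c * S (j * l)%N w); last exact/funext.
  by apply: pair_associated_increment => //; rewrite leq_mul2r leqnSn orbT.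
have main := lindeberg_sum a Y2 Y0 SY gC m t0t.
rewrite -/Y; set Vs := \sum_(j < m) v j in main *.
have Vs0 : 0 <= Vs by exact: sumr_ge0.
have liptime' := (gC _ (le_trans t0t (_ : t <= t + Vs))).
rewrite lerDl in liptime'; have {liptime'} [_ [_ liptime']] := liptime' Vs0.
have e2 : `|gauss (t + Vs) (- a) - gauss (t + s2) (- a)| <= C * `|Vs - s2|.
  apply: le_trans (liptime' _ _ _) _; first by rewrite (le_trans t0t)// lerDl.
  by rewrite opprD addrACA subrr add0r.
have lga : lipschitz_with C (fun x => gauss t (x - a)).
  by move=> x y; apply: le_trans (lip0 _ _) _; rewrite opprB addrA subrK.
have L1 k : (fun w => gauss t (c * S k w - a)) \in Lfun P 1.
  apply: Lfun21; apply: (lipschitz_with_Lfun2 lga (U := fun w => c * S k w)).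
  by rewrite LfunZ// partial_sum_Lfun2.
pose D w := c * (S n w - S (m * l)%N w).
have D2 : D \in Lfun P 2%:E by rewrite LfunZ// increment_Lfun2.
have nD1 : (fun w => `|D w|) \in Lfun P 1 by have := Lfun_norm (Lfun21 D2).
have e3 : `|mean P (fun w => gauss t (c * S n w - a)) -
    mean P (fun w => gauss t (c * S (m * l)%N w - a))| <=
    C * Num.sqrt (mean P (fun w => D w ^+ 2)).
  rewrite -meanB//; apply: (@le_trans _ _ (mean P (fun w => C * `|D w|))).
    apply: norm_mean_le => [||w].
    - exact: (LfunB (lexx 1) (L1 n) (L1 (m * l)%N)).
    - exact: (LfunZ C (lexx 1) nD1).
    by apply: le_trans (lip0 _ _) _; rewrite /D opprB addrA subrK mulrBr.
  by rewrite meanZ// ler_wpM2l// mean_norm_le.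
apply: le_trans (ler_distD (mean P (fun w => gauss t (c * S (m * l)%N w - a))) _ _) _.
rewrite [leRHS]addrC; apply: lerD; first exact: e3.
apply: le_trans (ler_distD (gauss (t + Vs) (- a)) _ _) _.
apply: lerD => //.
have e (f : R -> R) : (fun w => f (\sum_(i < m) Y i w)) = (fun w => f (c * S (m * l)%N w)).
  by apply/funext => w; rewrite YS.
by rewrite (e (fun x => gauss t (x - a))) (e (fun x => x ^+ 2)) in main.
Qed.

End Blocks.

(** * Integrals of the Gaussian kernel *)

Section GaussIntegral.
Variable R : realType.
Local Notation mu := (@lebesgue_measure R).

Lemma gauss_normal_pdf (t m a : R) : 0 < t -> gauss t (a - m) = normal_pdf m (Num.sqrt t) a.
Proof.
move=> t0; rewrite normal_pdfE ?gt_eqF ?sqrtr_gt0// /normal_peak /normal_fun.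
rewrite sqr_sqrtr ?ltW// /gauss.
have st : Num.sqrt t = expR (ln t / 2).
  rewrite -[in LHS](lnK t0) [in LHS](_ : ln t = ln t / 2 + ln t / 2); last by field.
  by rewrite expRD -expr2 sqrtr_sqr ger0_norm ?expR_ge0.
rewrite -mulrnAr sqrtrM ?ltW// st invfM -expRN opprD expRD.
rewrite [RHS](_ : _ = (Num.sqrt (pi *+ 2))^-1 * (expR (- (a - m) ^+ 2 / (t *+ 2)) *
  expR (- (ln t / 2)))); last by ring.
congr (_ * (expR _ * _)); field.
by rewrite gt_eqF.
Qed.

Lemma integral_gauss (t x : R) : 0 < t -> (\int[mu]_a (gauss t (x - a))%:E = 1)%E.
Proof.
move=> t0; under eq_integral do rewrite -gaussN opprB gauss_normal_pdf//.
exact: integral_normal_pdf.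
Qed.

Lemma continuous_gauss (t : R) : continuous (gauss t).
Proof.
move=> x; apply: differentiable_continuous; apply/derivable1_diffP.
exact: (@ex_derive _ _ _ _ _ _ _ (is_derive_gauss t x)).
Qed.

Lemma measurable_gauss (t : R) : measurable_fun setT (gauss t).
Proof. by apply: continuous_measurable_fun; exact: continuous_gauss. Qed.

Lemma integrable_gauss (t x : R) : 0 < t ->
  mu.-integrable setT (fun a => (gauss t (x - a))%:E).
Proof.
move=> t0; apply/integrableP; split.
  apply/measurable_EFinP; apply: (measurableT_comp (measurable_gauss t)).
  by apply: measurable_funB => //; exact: measurable_id.
under eq_integral do rewrite gee0_abs ?lee_fin ?gauss_ge0//.
by rewrite integral_gauss// ltry.
Qed.

Lemma integrable_scaled_gauss (k t x : R) : 0 < t ->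
  mu.-integrable setT (fun a => (k * gauss t (x - a))%:E).
Proof.
move=> t0; have := integrableZl measurableT k (integrable_gauss x t0).
by apply: eq_integrable => // a _; rewrite EFinM.
Qed.

Lemma Rintegral_scaled_gauss (k t x : R) : 0 < t ->
  \int[mu]_a (k * gauss t (x - a)) = k.
Proof.
move=> t0; rewrite RintegralZl//; last exact: integrable_gauss.
by rewrite /Rintegral integral_gauss//= mulr1.
Qed.

(** Gives the second moment of the kernel without computing it: the factor [z^2]
    is absorbed by doubling the variance. *)
Lemma sqr_gauss_le (e z : R) : 0 < e -> z ^+ 2 * gauss e z <= 8 * e * gauss (2 * e) z.
Proof.
move=> e0; rewrite /gauss mulrCA [leRHS]mulrCA ler_wpM2l ?invr_ge0//.
pose h := z ^+ 2 / e.
have h0 : 0 <= h by rewrite divr_ge0 ?sqr_ge0 ?ltW.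
have -> : - (z ^+ 2 / 2 * e^-1 + ln e / 2) = - (h / 4) + (- (h / 4) - ln e / 2).
  by rewrite /h; field; rewrite gt_eqF.
rewrite lnM ?posrE//.
have -> : - (z ^+ 2 / 2 * (2 * e)^-1 + (ln 2 + ln e) / 2) =
    - (ln 2 / 2) + (- (h / 4) - ln e / 2).
  by rewrite /h; field; rewrite gt_eqF.
rewrite !(expRD (- (_ / _))) !mulrA ler_wpM2r ?expR_ge0//.
have -> : z ^+ 2 = h * e by rewrite /h divfK ?gt_eqF.
have e1 : h * expR (- (h / 4)) <= 4.
  rewrite expRN ler_pdivrMr ?expR_gt0//.
  by have := expR_ge1Dx (h / 4); lra.
have e2 : 1 <= 2 * expR (- (ln 2 / 2)) :> R.
  rewrite -[X in X <= _](_ : 2 * expR (- ln 2) = 1); last first.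
    by rewrite expRN lnK ?posrE// divff.
  rewrite ler_pM2l// ler_expR lerN2 ler_pdivrMr// ler_peMr ?ler1n//.
  by rewrite ln_ge0// ler1n.
rewrite mulrAC [leRHS]mulrAC ler_wpM2r ?(ltW e0)//.
rewrite mulrAC [leRHS]mulrAC ler_wpM2r ?(ltW e0)//.
by apply: (le_trans e1); move: (expR _) e2 => B; lra.
Qed.

End GaussIntegral.

(** * Smoothing a distribution by Gaussian noise *)

Section GaussSmoothing.
Context d (T : measurableType d) (R : realType) (P : probability T R).
Local Notation mu := (@lebesgue_measure R).
Variables (Y : T -> R) (f : R -> R) (e M : R).
Hypotheses (mY : measurable_fun setT Y) (mf : measurable_fun setT f).
Hypotheses (fM : forall x, `|f x| <= M) (e0 : 0 < e).

(** The density at [a] of [Y + Z], with [Z] an independent centred normal variable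
    of variance [e]. *)
Definition smooth_density (a : R) : R := mean P (fun w => gauss e (Y w - a)).

(** The mean of [f (x + Z)], with [Z] as above. *)
Definition gauss_smooth (x : R) : R := \int[mu]_a (f a * gauss e (x - a)).

Let h (z : T * R) : \bar R := (f z.2 * gauss e (Y z.1 - z.2))%:E.

Let mh : measurable_fun setT h.
Proof.
apply/measurable_EFinP; apply: measurable_funM; first exact: measurableT_comp.
apply: (measurableT_comp (measurable_gauss e)).
by apply: measurable_funB => //; exact: measurableT_comp.
Qed.

Lemma integrable_mul_gauss (x : R) : mu.-integrable setT (fun a => (f a * gauss e (x - a))%:E).
Proof.
have i := integrableZl measurableT M (integrable_gauss x e0).
apply: (le_integrable _ _ _ i) => //.
  apply/measurable_EFinP; apply: measurable_funM => //.
  by apply: (measurableT_comp (measurable_gauss e)); apply: measurable_funB => //; exact: measurable_id.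
move=> a _; rewrite -EFinM !abse_EFin lee_fin !normrM ler_wpM2r//.
by rewrite (le_trans (fM a))// ler_norm.
Qed.

Let ih : (P \x mu)%E.-integrable setT h.
Proof.
apply/integrable12ltyP => //.
apply: (@le_lt_trans _ _ (\int[P]_w M%:E)%E); last first.
  by rewrite integral_cst//= probability_setT mule1 ltry.
have M0 : 0 <= M by apply: le_trans (fM 0).
apply: ge0_le_integral => //.
- by move=> w _; exact: integral_ge0.
- have mah : measurable_fun setT (abse \o h) by exact: measurableT_comp.
  exact: (measurable_fun_fubini_tonelli_F (m2 := mu) _ mah (fun z => abse_ge0 (h z))).
- move=> w _; apply: (@le_trans _ _ (\int[mu]_a (M%:E * (gauss e (Y w - a))%:E))%E).
    apply: ge0_le_integral => //.
    + apply: measurableT_comp => //.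
      by have /integrableP[] := integrable_mul_gauss (Y w).
    + by have /integrableP[] := integrableZl measurableT M (integrable_gauss (Y w) e0).
    + move=> a _; rewrite /h abse_EFin -EFinM lee_fin normrM ler_pM//.
      by rewrite ger0_norm ?gauss_ge0.
  rewrite integralZl//; last exact: integrable_gauss.
  by rewrite integral_gauss// mule1.
Qed.

Lemma gauss_smooth_le x : `|gauss_smooth x| <= M.
Proof.
apply: le_trans (le_normr_Rintegral _ (integrable_mul_gauss x)) _ => //.
have Mi := integrableZl measurableT M (integrable_gauss x e0).
have -> : M = \int[mu]_a (M * gauss e (x - a)).
  by rewrite Rintegral_scaled_gauss.
apply: le_Rintegral => //.
  by have /integrable_norm := integrable_mul_gauss x.
by move=> a _; rewrite normrM ler_pM// ger0_norm ?gauss_ge0.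
Qed.

Let gauss_L1 a : (fun w => gauss e (Y w - a)) \in Lfun P 1.
Proof.
apply: (@Lfun_bounded _ _ _ _ _ _ ((Num.sqrt (pi *+ 2))^-1 * expR (- (ln e / 2)))) => //.
  by apply: (measurableT_comp (measurable_gauss e)); apply: measurable_funB => //; exact: measurable_id.
move=> w; rewrite ger0_norm ?gauss_ge0// /gauss ler_wpM2l ?invr_ge0//.
rewrite ler_expR lerN2 lerDr mulr_ge0 ?divr_ge0 ?sqr_ge0//.
by rewrite invr_ge0 ltW.
Qed.

Let GE a : (\int[P]_w h (w, a) = (f a * smooth_density a)%:E)%E.
Proof.
rewrite /h /=; under eq_integral do rewrite EFinM.
rewrite integralZl//; last exact/Lfun1_integrable.
by rewrite EFinM -(expectation_mean (gauss_L1 a)) unlock.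
Qed.

Let FE w : (\int[mu]_a h (w, a) = (gauss_smooth (Y w))%:E)%E.
Proof.
rewrite /gauss_smooth /Rintegral fineK//.
by apply: integrable_fin_num => //; exact: integrable_mul_gauss.
Qed.

Lemma integrable_mul_density : mu.-integrable setT (fun a => (f a * smooth_density a)%:E).
Proof.
have mG : measurable_fun setT (fun a => (f a * smooth_density a)%:E).
  by have := measurable_fubini_G ih; apply: eq_measurable_fun => a _; exact: GE.
apply/integrableP; split => //.
apply: le_lt_trans ((integrable21ltyP P mu mh).1 ih).
have mah : measurable_fun setT (abse \o h) by exact: measurableT_comp.
apply: ge0_le_integral => //.
- exact: measurableT_comp.
- exact: (measurable_fun_fubini_tonelli_G (m1 := P) _ mah (fun z => abse_ge0 (h z))).
- move=> a _; rewrite -GE; apply: le_abse_integral => //.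
  have : (fun w => f a * gauss e (Y w - a)) \in Lfun P 1 by exact: (LfunZ (f a) (lexx 1) (gauss_L1 a)).
  by move/Lfun1_integrable/integrableP => [].
Qed.

Lemma gauss_smooth_Lfun1 : (fun w => gauss_smooth (Y w)) \in Lfun P 1.
Proof.
apply/Lfun1_integrable; have := integrable_fubini_F ih.
apply: eq_integrable => // w _; exact: FE.
Qed.

(** Both sides are the mean of [f (Y + Z)]; this is Fubini's theorem. *)
Lemma mean_gauss_smooth : mean P (fun w => gauss_smooth (Y w)) = \int[mu]_a (f a * smooth_density a).
Proof.
rewrite /mean /Rintegral; congr fine.
under eq_integral do rewrite -FE.
under [RHS]eq_integral do rewrite -GE.
exact: (Fubini ih).
Qed.

(** Within distance [rho] the oscillation of [f] is at most [eta]; beyond, it is at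
    most [2 M], and Chebyshev's inequality bounds the mass of the noise there. *)
Lemma gauss_smooth_approx (x eta rho : R) : 0 <= eta -> 0 < rho ->
  (forall z, `|z| <= rho -> `|f (x + z) - f x| <= eta) ->
  `|gauss_smooth x - f x| <= eta + 16 * M * e / rho ^+ 2.
Proof.
move=> eta0 rho0 fx.
have M0 : 0 <= M by apply: le_trans (fM 0).
have e20 : 0 < 2 * e by rewrite mulr_gt0.
(* [2 M <= k (a - x)^2] as soon as [|a - x| > rho]. *)
pose k := 2 * M / rho ^+ 2.
have k0 : 0 <= k by rewrite divr_ge0 ?sqr_ge0// mulr_ge0.
have ig := integrable_gauss x e0; have i2g := integrable_gauss x e20.
have ifx : mu.-integrable setT (fun a => (f x * gauss e (x - a))%:E).
  exact: integrable_scaled_gauss.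
have -> : f x = \int[mu]_a (f x * gauss e (x - a)).
  by rewrite Rintegral_scaled_gauss.
rewrite -RintegralB//; last exact: integrable_mul_gauss.
have i1 : mu.-integrable setT (fun a => (eta * gauss e (x - a))%:E).
  exact: integrable_scaled_gauss.
have i2 : mu.-integrable setT (fun a => ((k * (8 * e)) * gauss (2 * e) (x - a))%:E).
  exact: integrable_scaled_gauss.
have i12 : mu.-integrable setT (fun a =>
   (eta * gauss e (x - a) + (k * (8 * e)) * gauss (2 * e) (x - a))%:E).
  by have := integrableD measurableT i1 i2; apply: eq_integrable => // a _; rewrite EFinD.
have iD : mu.-integrable setT (fun a => (f a * gauss e (x - a) - f x * gauss e (x - a))%:E).
  have := integrableB measurableT (integrable_mul_gauss x) ifx.
  by apply: eq_integrable => // a _; rewrite EFinB.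
apply: le_trans (le_normr_Rintegral _ iD) _ => //.
apply: (@le_trans _ _ (\int[mu]_a
   (eta * gauss e (x - a) + (k * (8 * e)) * gauss (2 * e) (x - a)))); last first.
  rewrite RintegralD// !Rintegral_scaled_gauss// lerD2l.
  by rewrite /k le_eqVlt; apply/orP; left; apply/eqP; field; rewrite gt_eqF.
apply: le_Rintegral => //; first exact: (integrable_norm iD).
move=> a _; rewrite -mulrBl normrM (ger0_norm (gauss_ge0 _ _)).
have [ax|ax] := leP `|a - x| rho.
  have := fx _ ax; rewrite [x + _]addrC subrK => h1.
  apply: (@le_trans _ _ (eta * gauss e (x - a))); first by rewrite ler_wpM2r ?gauss_ge0.
  by rewrite lerDl mulr_ge0 ?gauss_ge0// mulr_ge0// mulr_ge0// ltW.
have f2M : `|f a - f x| <= 2 * M.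
  by apply: le_trans (ler_normB _ _) _; rewrite mulrDl mul1r lerD.
apply: (@le_trans _ _ (k * ((x - a) ^+ 2 * gauss e (x - a)))).
  rewrite mulrA ler_wpM2r ?gauss_ge0// (le_trans f2M)// /k mulrAC.
  rewrite ler_pdivlMr ?exprn_gt0// ler_wpM2l ?mulr_ge0//.
  by rewrite -[(x - a) ^+ 2]real_normK ?num_real// distrC lerXn2r ?nnegrE ?(ltW rho0) ?(ltW ax)//.
apply: (@le_trans _ _ (k * (8 * e * gauss (2 * e) (x - a)))).
  by rewrite ler_wpM2l// sqr_gauss_le.
by rewrite mulrA lerDr mulr_ge0 ?gauss_ge0.
Qed.

End GaussSmoothing.

(** * The lemma of Scheffe *)

Section Scheffe.
Context d (T : measurableType d) (R : realType).
Variable mu : {measure set T -> \bar R}.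

(** As both integrals are equal, the integral of [|p_n - p|] is twice that of the
    positive part of [p - p_n], which is dominated by [p]. *)
Lemma scheffe (p_ : nat -> T -> R) (p : T -> R) (I : R) :
  (forall n, mu.-integrable setT (EFin \o p_ n)) -> mu.-integrable setT (EFin \o p) ->
  (forall n x, 0 <= p_ n x) ->
  (forall n, \int[mu]_x p_ n x = I) -> \int[mu]_x p x = I ->
  (forall x, p_ n x @[n --> \oo] --> p x) ->
  \int[mu]_x `|p_ n x - p x| @[n --> \oo] --> 0.
Proof.
move=> ip_ ip p0 Ip_ Ip pp.
pose q n x := Num.max (p x - p_ n x) 0.
have mp : measurable_fun setT p by apply/measurable_EFinP; exact: measurable_int ip.
have mp_ n : measurable_fun setT (p_ n) by apply/measurable_EFinP; exact: measurable_int (ip_ n).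
have p_ge0 x : 0 <= p x.
  have <- := cvg_lim (@Rhausdorff R) (pp x).
  by apply: limr_ge; [exact: cvgP (pp x)|apply: nearW => n; exact: p0].
have mq n : measurable_fun setT (q n).
  by apply: measurable_maxr => //; exact: measurable_funB.
have q_ge0 n x : 0 <= q n x by rewrite le_max lexx orbT.
have qp n x : q n x <= p x by rewrite ge_max p_ge0 andbT lerBlDr lerDl p0.
have hq x : q n x @[n --> \oo] --> (0 : R).
  have : (p x - p_ n x) @[n --> \oo] --> (0 : R).
    by rewrite -[X in _ --> X](subrr (p x)); apply: cvgB => //; exact: cvg_cst.
  move=> h; apply/cvgrPdist_le => eps eps0.
  have /cvgrPdist_le/(_ _ eps0) := h; apply: filterS => n; rewrite !sub0r !normrN.
  apply: le_trans; rewrite /q; have [_|h0] := leP (p x - p_ n x) 0.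
    by rewrite normr0.
  by [].
have [|||||_ _ cvgq] := @dominated_convergence _ _ _ mu setT measurableT
    (fun n x => (q n x)%:E) (cst 0%E) (EFin \o p).
- by move=> n; exact/measurable_EFinP.
- exact: measurable_cst.
- by apply: nearW => x _; apply/fine_cvgP; split; [exact: nearW|exact: hq].
- exact: ip.
- by apply: nearW => x n _; rewrite gee0_abs ?lee_fin.
have iq n : mu.-integrable setT (EFin \o q n).
  apply: (le_integrable _ _ _ ip) => //; first exact/measurable_EFinP.
  by move=> x _ /=; rewrite lee_fin !ger0_norm.
have E n : \int[mu]_x `|p_ n x - p x| = 2 * \int[mu]_x q n x.
  rewrite -RintegralZl//.
  have -> : \int[mu]_x (2 * q n x) = \int[mu]_x (2 * q n x) + (\int[mu]_x p_ n x - \int[mu]_x p x).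
    by rewrite Ip_ Ip subrr addr0.
  have i2q : mu.-integrable setT (EFin \o (fun x => 2 * q n x)).
    by have := integrableZl measurableT 2 (iq n); apply: eq_integrable => // x _ /=; rewrite EFinM.
  have iB : mu.-integrable setT (EFin \o (fun x => p_ n x - p x)).
    by have := integrableB measurableT (ip_ n) ip; apply: eq_integrable => // x _ /=; rewrite EFinB.
  rewrite -RintegralB// -RintegralD//.
  apply: eq_Rintegral => x _; rewrite /q; have [h|h] := leP (p x - p_ n x) 0.
    by rewrite mulr0 add0r ger0_norm// -opprB oppr_ge0.
  by rewrite ltr0_norm; [ring|rewrite -opprB oppr_lt0].
under eq_fun do rewrite E.
rewrite -(mulr0 2); apply: cvgMr.
by apply: fine_cvg; rewrite integral0 in cvgq.
Qed.

End Scheffe.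

(** * Uniform continuity on segments *)

Section UniformContinuity.
Variable R : realType.

(** Only [x] is confined to the segment: [x + z] may leave it. *)
Lemma continuous_unif_on_segment (f : R -> R) (K eta : R) : continuous f -> 0 < eta ->
  exists2 rho, 0 < rho & forall x z, `|x| <= K -> `|z| <= rho -> `|f (x + z) - f x| <= eta.
Proof.
move=> cf eta0.
have /compact_near_coveringP cov := @segment_compact R (- K) K.
have key x : `[- K, K]%classic x -> \forall x' \near x & rho \near (0 : R)^'+,
    forall z, `|z| <= rho -> `|f (x' + z) - f x'| <= eta.
  move=> _; have eta20 : 0 < eta / 2 by rewrite divr_gt0.
  have /cvgrPdist_lt/(_ _ eta20)/nbhs_ballP[del /= del0 fdel] := cf x.
  have del20 : 0 < del / 2 by rewrite divr_gt0.
  exists (ball x (del / 2), [set rho | rho < del / 2]) => /=.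
    by split; [exact: nbhsx_ballx|exact: nbhs_right_lt].
  move=> [x' rho] /= [xx' rhod] z zrho.
  have h1 : `|f x - f x'| < eta / 2.
    by apply: fdel; apply: (lt_le_trans xx'); rewrite ler_pdivrMr// ler_peMr ?ler1n// ltW.
  have h2 : `|f x - f (x' + z)| < eta / 2.
    apply: fdel; rewrite /ball/= opprD addrA; apply: le_lt_trans (ler_normB _ _) _.
    rewrite [ltRHS](splitr del); apply: ltrD; first exact: xx'.
    exact: le_lt_trans zrho rhod.
  rewrite (_ : f (x' + z) - f x' = (f x - f x') - (f x - f (x' + z))); last by ring.
  apply: le_trans (ler_normB _ _) _; rewrite [leRHS](splitr eta).
  by apply: lerD; exact: ltW.
have near_rho := cov R (0^'+) _ _ key.
have [rho [rho0 hrho]] : exists rho : R, 0 < rho /\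
    (`[- K, K] `<=` [set x | forall z, `|z| <= rho -> `|f (x + z) - f x| <= eta])%classic.
  near (0 : R)^'+ => rho; exists rho; split; first by near: rho; exact: nbhs_right_gt.
  by near: rho; exact: near_rho.
exists rho => // x z xK zrho; apply: hrho => //=.
by rewrite in_itv/= -ler_norml.
Unshelve. all: by end_near. Qed.

End UniformContinuity.

(** * Weak convergence from smoothed densities *)

Section WeakConvergence.
Context d (T : measurableType d) (R : realType) (P : probability T R).
Local Notation mu := (@lebesgue_measure R).

(** The noise level [e] depends on [f] and on the bound [V] of the second moment,
    not on the variable: it can be chosen once for a whole sequence and its limit.
    On [|Y| <= K] uniform continuity applies, and [K] is such that the event
    [|Y| > K] contributes little by Chebyshev's inequality. *)
Lemma gauss_smoothing_error (f : R -> R) (M V eta : R) : continuous f ->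
  (forall x, `|f x| <= M) -> 0 <= V -> 0 < eta ->
  exists2 e, 0 < e & forall d' (T' : measurableType d') (Q : probability T' R) (Y : T' -> R),
    Y \in Lfun Q 2%:E -> mean Q (fun w => Y w ^+ 2) <= V ->
    `|mean Q (f \o Y) - \int[mu]_a (f a * smooth_density Q Y e a)| <= eta.
Proof.
move=> cf fM V0 eta0; have M0 : 0 <= M by apply: le_trans (fM 0).
have mf : measurable_fun setT f by exact: continuous_measurable_fun.
have eta30 : 0 < eta / 3 by rewrite divr_gt0.
(* [K] makes the contribution [2 M V / K^2] of the tail at most [eta / 3]. *)
pose K := Num.sqrt (6 * (M * V + 1) / eta).
have K2 : K ^+ 2 = 6 * (M * V + 1) / eta.
  by rewrite sqr_sqrtr// divr_ge0 ?(ltW eta0)// mulr_ge0// addr_ge0// mulr_ge0.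
have K20 : 0 < K ^+ 2.
  by rewrite K2 divr_gt0// mulr_gt0// ltr_wpDl// mulr_ge0.
have K0 : 0 <= K by exact: sqrtr_ge0.
have [rho rho0 unif] := continuous_unif_on_segment K cf eta30.
(* [e] makes the error [16 M e / rho^2] of the smoothing at most [eta / 3]. *)
pose e := eta / 3 * rho ^+ 2 / (16 * (M + 1)).
have M1 : 0 < M + 1 by rewrite ltr_wpDl.
have e0 : 0 < e by rewrite divr_gt0// ?mulr_gt0// exprn_gt0.
have eb : 16 * M * e / rho ^+ 2 <= eta / 3.
  rewrite ler_pdivrMr ?exprn_gt0// /e mulrA ler_pdivrMr ?mulr_gt0//.
  rewrite mulrC ler_wpM2l//; first by rewrite mulr_ge0 ?exprn_ge0 ?ltW.
  by rewrite ler_pM2l// lerDl.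
exists e => // d' T' Q Y Y2 YV.
have mY := Lfun_measurable Y2.
rewrite -(mean_gauss_smooth Q mY mf fM e0).
have fY1 : f \o Y \in Lfun Q 1.
  by apply: (@Lfun_bounded _ _ _ Q 1 _ M) => [||w]; [exact: lexx|exact: measurableT_comp|exact: fM].
have sY1 := gauss_smooth_Lfun1 Q mY mf fM e0.
rewrite -meanB//.
have Y21 := Lfun2_sqr Y2.
pose b w := 2 * (eta / 3) + 2 * M / K ^+ 2 * Y w ^+ 2.
have b1 : b \in Lfun Q 1 by rewrite LfunD ?LfunZ ?Lfun_cst.
apply: (@le_trans _ _ (mean Q b)).
  apply: norm_mean_le => //; first exact: (LfunB (lexx 1) fY1 sY1).
  move=> w; rewrite distrC /b /=.
  have [YK|YK] := leP `|Y w| K.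
    apply: le_trans (gauss_smooth_approx mf fM e0 (ltW eta30) rho0 (unif _ ^~ YK)) _.
    have h0 : 0 <= 2 * M / K ^+ 2 * Y w ^+ 2.
      by rewrite mulr_ge0 ?sqr_ge0// divr_ge0 ?sqr_ge0// mulr_ge0.
    by move: (_ * Y w ^+ 2) h0 (16 * M * e / _) eb => h h0 g eb; lra.
  apply: (@le_trans _ _ (2 * M)).
    apply: le_trans (ler_normB _ _) _.
    by rewrite mulrDl mul1r lerD// (gauss_smooth_le).
  apply: (@le_trans _ _ (2 * M / K ^+ 2 * Y w ^+ 2)).
    2: by rewrite lerDr mulr_ge0 ?(ltW eta30).
  rewrite -[leRHS]mulrA ler_peMr ?mulr_ge0// mulrC ler_pdivlMr// mul1r.
  by rewrite -[leRHS]real_normK ?num_real// lerXn2r ?nnegrE// ltW.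
rewrite meanD ?LfunZ ?Lfun_cst// mean_cst meanZ//.
rewrite [leRHS](_ : _ = 2 * (eta / 3) + eta / 3); last by field.
rewrite lerD2l.
apply: (@le_trans _ _ (2 * M / K ^+ 2 * V)).
  by rewrite ler_wpM2l// divr_ge0 ?sqr_ge0// mulr_ge0.
rewrite mulrAC ler_pdivrMr// K2.
rewrite [leRHS](_ : _ = 2 * (M * V + 1)); last by field; rewrite gt_eqF.
by rewrite -mulrA ler_pM2l// lerDl.
Qed.

(** By the hypothesis the densities of the smoothed variables converge pointwise,
    hence in [L^1]; the error of the smoothing is uniform along the sequence. *)
Lemma weakly_converges_gauss (Y : nat -> T -> R) (nu : probability (measurableTypeR R) R) (V : R) :
  0 <= V -> (forall n, Y n \in Lfun P 2%:E) -> (forall n, mean P (fun w => Y n w ^+ 2) <= V) ->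
  (id : measurableTypeR R -> R) \in Lfun nu 2%:E -> mean nu (fun x => x ^+ 2) <= V ->
  (forall e a, 0 < e -> mean P (fun w => gauss e (Y n w - a)) @[n --> \oo] -->
     mean nu (fun x => gauss e (x - a))) ->
  weakly_converges P Y nu.
Proof.
move=> V0 Y2 YV id2 idV Yg f cf bf.
have [M fM] : exists M, forall x, `|f x| <= M.
  have [M [_ hM]] := bf; exists (M + 1) => x.
  by apply: (hM (M + 1)) => //; rewrite ltrDl.
have M0 : 0 <= M by apply: le_trans (fM 0).
have mf : measurable_fun setT f by exact: continuous_measurable_fun.
have fY1 n : f \o Y n \in Lfun P 1.
  apply: (@Lfun_bounded _ _ _ P 1 _ M) => [||w]; [exact: lexx| |exact: fM].
  exact: measurableT_comp (Lfun_measurable (Y2 n)).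
have f1 : (f : measurableTypeR R -> R) \in Lfun nu 1 by exact: (@Lfun_bounded _ _ _ nu 1 _ M).
have -> : (fun n => 'E_P[f \o Y n])%E = (fun n => (mean P (f \o Y n))%:E).
  by apply/funext => n; rewrite expectation_mean.
have -> : (\int[nu]_x (f x)%:E)%E = (mean nu f)%:E.
  by rewrite -expectation_mean// unlock.
apply/fine_cvgP; split; first exact: nearW.
rewrite /comp /=; apply/cvgrPdist_le => eta eta0.
have eta40 : 0 < eta / 4 by rewrite divr_gt0.
have [e e0 he] := gauss_smoothing_error cf fM V0 eta40.
have mY n := Lfun_measurable (Y2 n).
have mid : measurable_fun setT (id : measurableTypeR R -> R) by exact: measurable_id.
have c1 : measurable_fun setT (cst 1 : R -> R) by exact: measurable_cst.
have b1 (x : R) : `|cst 1 x| <= 1 :> R by rewrite normr1.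
pose p n a := smooth_density P (Y n) e a.
pose q a := smooth_density nu id e a.
have ip n : mu.-integrable setT (EFin \o p n).
  have := integrable_mul_density P (mY n) c1 b1 e0.
  by apply: eq_integrable => // a _ /=; rewrite mul1r.
have iq : mu.-integrable setT (EFin \o q).
  have := integrable_mul_density nu mid c1 b1 e0.
  by apply: eq_integrable => // a _ /=; rewrite mul1r.
have s1 x : gauss_smooth (cst 1) e x = 1.
  by rewrite /gauss_smooth Rintegral_scaled_gauss.
have Ip n : \int[mu]_a p n a = 1.
  have := mean_gauss_smooth P (mY n) c1 b1 e0.
  under eq_mean do rewrite s1.
  rewrite mean_cst => ->; apply: eq_Rintegral => a _; by rewrite mul1r.
have Iq : \int[mu]_a q a = 1.
  have := mean_gauss_smooth nu mid c1 b1 e0.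
  under eq_mean do rewrite s1.
  rewrite mean_cst => ->; apply: eq_Rintegral => a _; by rewrite mul1r.
have sch : \int[mu]_a `|p n a - q a| @[n --> \oo] --> 0.
  apply: (scheffe ip iq _ Ip Iq) => [n a|a].
    by apply: mean_ge0 => w; exact: gauss_ge0.
  exact: Yg.
have eM : 0 < eta / 4 / (M + 1) by rewrite divr_gt0// ltr_wpDl.
have /cvgrPdist_le/(_ _ eM) := sch; apply: filterS => n.
rewrite sub0r normrN ger0_norm; last exact: Rintegral_ge0.
move=> hn.
have e1 := he _ _ nu id id2 idV; have e2 := he _ _ P (Y n) (Y2 n) (YV n).
have ifp := integrable_mul_density P (mY n) mf fM e0.
have ifq := integrable_mul_density nu mid mf fM e0.
have e3 : `|\int[mu]_a (f a * q a) - \int[mu]_a (f a * p n a)| <= eta / 4.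
  rewrite -RintegralB//.
  have iB : mu.-integrable setT (fun a => (f a * q a - f a * p n a)%:E).
    by have := integrableB measurableT ifq ifp; apply: eq_integrable => // x _ /=; rewrite EFinB.
  apply: le_trans (le_normr_Rintegral _ iB) _ => //.
  have ipq : mu.-integrable setT (EFin \o (fun a => `|p n a - q a|)).
    have := integrable_norm (integrableB measurableT (ip n) iq).
    by apply: eq_integrable => // x _ /=; rewrite -EFinB.
  apply: (@le_trans _ _ (\int[mu]_a (M * `|p n a - q a|))).
    apply: le_Rintegral => //; first exact: (integrable_norm iB).
    - by have := integrableZl measurableT M ipq; apply: eq_integrable => // x _ /=; rewrite EFinM.
    - by move=> a _; rewrite -mulrBr normrM distrC ler_wpM2r.
  rewrite RintegralZl//; apply: (@le_trans _ _ (M * (eta / 4 / (M + 1)))).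
    by rewrite ler_wpM2l.
  rewrite mulrA ler_pdivrMr ?ltr_wpDl// mulrC ler_wpM2l ?(ltW eta40)//.
  by rewrite lerDl.
apply: le_trans (ler_distD (\int[mu]_a (f a * q a)) _ _) _.
rewrite (_ : eta = eta / 4 + (eta / 4 + eta / 4) + eta / 4); last by field.
rewrite -addrA; apply: lerD; first exact: e1.
apply: le_trans (ler_distD (\int[mu]_a (f a * p n a)) _ _) _.
apply: lerD; first by apply: (le_trans e3); rewrite lerDl ltW.
by rewrite distrC.
Qed.

End WeakConvergence.

(** * The normal law against Gaussian kernels *)

Section NormalLaw.
Variable R : realType.
Local Notation mu := (@lebesgue_measure R).

(** The normal law is defined by its density on sets; the Radon-Nikodym derivative
    extends this to integrals of nonnegative functions. *)
Lemma ge0_integral_normal_prob (m s : R) (f : R -> \bar R) :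
  measurable_fun setT f -> (forall x, 0 <= f x)%E ->
  (\int[normal_prob m s]_x f x = \int[mu]_x (f x * (normal_pdf m s x)%:E))%E.
Proof.
move=> mf f0; have dom := normal_prob_dominates m s.
rewrite -(Radon_Nikodym_SigmaFinite.change_of_variables dom)//.
have irn := Radon_Nikodym_SigmaFinite.f_integrable dom.
have mpdf : measurable_fun setT (fun x => (normal_pdf m s x)%:E).
  by apply/measurable_EFinP; exact: measurable_normal_pdf.
apply: ae_eq_integral => //.
- by apply: emeasurable_funM => //; exact: measurable_int irn.
- exact: emeasurable_funM.
- apply: ae_eqe_mul2l; apply: integral_ae_eq => // A _ mA.
  by rewrite -Radon_Nikodym_SigmaFinite.f_integral.
Qed.

(** Completing the square. *)
Lemma gauss_mul (e v a x : R) : 0 < e -> 0 < v ->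
  gauss e (x - a) * gauss v x =
  gauss (e + v) (- a) * gauss (e * v / (e + v)) (a * v / (e + v) - x).
Proof.
move=> e0 v0; have ev0 : 0 < e + v by rewrite addr_gt0.
rewrite /gauss mulrACA [RHS]mulrACA; congr (_ * _).
rewrite -!expRD; congr expR.
rewrite ln_div ?posrE ?mulr_gt0// lnM ?posrE//.
by field; rewrite !gt_eqF.
Qed.

Lemma ge0_integral_normal_law (v : R) (f : R -> \bar R) : 0 < v ->
  measurable_fun setT f -> (forall x, 0 <= f x)%E ->
  (\int[normal_law 0 v]_x f x = \int[mu]_x (f x * (gauss v x)%:E))%E.
Proof.
move=> v0 mf f0; rewrite /normal_law (gt_eqF v0) ge0_integral_normal_prob//.
by apply: eq_integral => x _; rewrite -gauss_normal_pdf// subr0.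
Qed.

Lemma mean_gauss_normal_law (e v a : R) : 0 < e -> 0 <= v ->
  mean (normal_law 0 v) (fun x => gauss e (x - a)) = gauss (e + v) (- a).
Proof.
move=> e0; rewrite le_eqVlt => /predU1P[<-|v0]; have mg : measurable_fun setT (fun x : R => gauss e (x - a)).
- by apply: (measurableT_comp (measurable_gauss e)); apply: measurable_funB => //; exact: measurable_id.
- rewrite /mean /Rintegral /normal_law eqxx integral_dirac//; last exact/measurable_EFinP.
  by rewrite diracT mul1e/= sub0r addr0.
- by apply: (measurableT_comp (measurable_gauss e)); apply: measurable_funB => //; exact: measurable_id.
rewrite /mean /Rintegral ge0_integral_normal_law//; last 2 first.
- exact/measurable_EFinP.
- by move=> x; rewrite lee_fin gauss_ge0.
have w0 : 0 < e * v / (e + v) by rewrite divr_gt0 ?mulr_gt0 ?addr_gt0.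
under eq_integral do rewrite -EFinM gauss_mul// EFinM.
rewrite integralZl//; last exact: integrable_gauss.
by rewrite integral_gauss// mule1.
Qed.

(** The constant 8 comes from [sqr_gauss_le]. *)
Lemma normal_law_second_moment (v : R) : 0 <= v ->
  (id : measurableTypeR R -> R) \in Lfun (normal_law 0 v) 2%:E /\
  mean (normal_law 0 v) (fun x => x ^+ 2) <= 8 * v.
Proof.
move=> v_ge0.
have mX : measurable_fun setT (fun x : R => (x ^+ 2)%:E).
  by apply/measurable_EFinP; apply: measurable_funX; exact: measurable_id.
have main : (\int[normal_law 0 v]_x (x ^+ 2)%:E <= (8 * v)%:E)%E.
  move: v_ge0; rewrite le_eqVlt => /predU1P[<-|v0].
    rewrite /normal_law eqxx integral_dirac//.
    by rewrite diracT mul1e expr0n/= mulr0.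
  have v20 : 0 < 2 * v by rewrite mulr_gt0.
  rewrite ge0_integral_normal_law//; last by move=> x; rewrite lee_fin sqr_ge0.
  apply: (@le_trans _ _ (\int[mu]_x ((8 * v)%:E * (gauss (2 * v) (0 - x))%:E))%E); last first.
    by rewrite integralZl ?integral_gauss ?mule1//; exact: integrable_gauss.
  apply: ge0_le_integral => //.
  - by move=> x _; rewrite -EFinM lee_fin mulr_ge0 ?sqr_ge0 ?gauss_ge0.
  - by apply: emeasurable_funM => //; apply/measurable_EFinP; exact: measurable_gauss.
  - apply: emeasurable_funM => //; apply/measurable_EFinP.
    by apply: (measurableT_comp (measurable_gauss _)); apply: measurable_funB => //; exact: measurable_id.
  - move=> x _; rewrite -!EFinM lee_fin sub0r gaussN; exact: sqr_gauss_le.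
have i2 : (fun x : measurableTypeR R => x ^+ 2) \in Lfun (normal_law 0 v) 1.
  apply/Lfun1_integrable; apply/integrableP; split => //.
  apply: le_lt_trans (ltry (8 * v)); apply: le_trans main.
  rewrite le_eqVlt; apply/orP; left; apply/eqP; apply: eq_integral => x _ /=.
  by rewrite ger0_norm ?sqr_ge0.
split; first by apply: Lfun2P => //; exact: measurable_id.
by rewrite -lee_fin -expectation_mean// unlock.
Qed.

End NormalLaw.

(** * Moments of order larger than two *)

Section PowerMoments.
Context d (T : measurableType d) (R : realType) (P : probability T R).

Lemma Lfun2_of_power (f : T -> R) (p : R) : measurable_fun setT f -> 2 <= p ->
  ('E_P[fun w => (`|f w| `^ p)%R] < +oo)%E -> f \in Lfun P 2%:E.
Proof.
move=> mf p2; rewrite unlock => fp.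
have mfp : measurable_fun setT (fun w => `|f w| `^ p).
  apply: (measurableT_comp (measurable_powR _)) => //; exact: measurableT_comp.
have fp1 : (fun w => `|f w| `^ p) \in Lfun P 1.
  apply/Lfun1_integrable/integrableP; split; first exact/measurable_EFinP.
  by under eq_integral do rewrite /= ger0_norm ?powR_ge0//.
have g1 : (fun w => 1 + `|f w| `^ p) \in Lfun P 1.
  by apply: (LfunD (lexx 1)) => //; exact: Lfun_cst.
apply: Lfun2P => //; apply: (Lfun1_dom _ g1); first exact: measurable_funX.
move=> w; rewrite ger0_norm ?sqr_ge0// -[leLHS]real_normK ?num_real//.
have [f1|f1] := leP `|f w| 1.
  apply: (@le_trans _ _ 1); first by rewrite expr_le1.
  by rewrite lerDl powR_ge0.
rewrite -powR_mulrn//; apply: (@le_trans _ _ (`|f w| `^ p)).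
  by apply: ler_powR => //; exact: ltW.
by rewrite lerDr.
Qed.

(** For [|y| <= eta] one has [|y|^3 <= eta y^2]; for [|y| > eta] the quadratic part
    is multiplied by [(|y| / eta)^delta >= 1]. *)
Lemma cubic_cut_le_power (y eta delta : R) : 0 < eta -> 0 < delta ->
  cubic_cut y <= eta * y ^+ 2 + eta^-1 `^ delta * `|y| `^ (2 + delta).
Proof.
move=> eta0 delta0; rewrite /cubic_cut.
have [ye|ye] := leP `|y| eta.
  apply: (@le_trans _ _ (eta * y ^+ 2)); last first.
    by rewrite lerDl mulr_ge0// powR_ge0.
  rewrite ge_min; apply/orP; right.
  by rewrite exprS real_normK ?num_real// ler_wpM2r// sqr_ge0.
have y0 : 0 < `|y| by apply: lt_trans ye.
apply: (@le_trans _ _ (y ^+ 2)); first by rewrite ge_min lexx.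
rewrite powRD; last by rewrite (gt_eqF y0) implybT.
rewrite -[2]/(2%:R) powR_mulrn// real_normK ?num_real// [X in _ + X]mulrCA -powRM ?invr_ge0 ?(ltW eta0)//.
apply: (@le_trans _ _ (y ^+ 2 * (eta^-1 * `|y|) `^ delta)).
  rewrite ler_peMr ?sqr_ge0// -[leLHS](powRr0 (eta^-1 * `|y|)) ler_powR//.
    by rewrite mulrC ler_pdivlMr// mul1r ltW.
  exact: ltW.
by rewrite lerDr mulr_ge0 ?sqr_ge0// ltW.
Qed.

End PowerMoments.

(** * Variances and moments of normalized blocks *)

Section BlockMoments.
Context d (T : measurableType d) (R : realType) (P : probability T R).
Variable X : nat -> {RV P >-> R}.
Hypotheses (X_assoc : associated X) (X2 : forall i, (X i : T -> R) \in Lfun P 2%:E).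
Hypothesis X0 : forall i, mean P (X i) = 0.
Local Notation S := (partial_sum X).

Lemma mean_sqr_scale (c : R) (f : T -> R) : f \in Lfun P 2%:E ->
  mean P (fun w => (c * f w) ^+ 2) = c ^+ 2 * mean P (fun w => f w ^+ 2).
Proof.
move=> f2; rewrite -meanZ ?Lfun2_sqr//; apply: eq_mean => w; exact: exprMn.
Qed.

Lemma variance_mean_sqr (f : T -> R) : f \in Lfun P 2%:E -> mean P f = 0 ->
  ('V_P[f] = (mean P (fun w => f w ^+ 2))%:E)%E.
Proof.
by move=> f2 f0; rewrite /variance covariance_cov// /cov f0 mulr0 subr0.
Qed.

Lemma sum_std_sqr n : sum_std X n ^+ 2 = mean P (fun w => S n w ^+ 2).
Proof.
have S2 := partial_sum_Lfun2 X2.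
rewrite /sum_std variance_mean_sqr ?mean_partial_sum//= sqr_sqrtr//.
by apply: mean_ge0 => w; exact: sqr_ge0.
Qed.

Lemma block_Lfun2 c l j : block X c l j \in Lfun P 2%:E.
Proof. by rewrite LfunZ ?ler1n// increment_Lfun2. Qed.

(** By induction from the superadditivity of the variance. *)
Lemma sum_blocks_le (c : R) (l m : nat) :
  \sum_(j < m) mean P (fun w => block X c l j w ^+ 2) <=
  mean P (fun w => (c * S (m * l)%N w) ^+ 2).
Proof.
elim: m => [|m ih].
  by rewrite big_ord0; apply: mean_ge0 => w; exact: sqr_ge0.
rewrite big_ord_recr/=; apply: le_trans (lerD ih (lexx _)) _.
rewrite !mean_sqr_scale ?partial_sum_Lfun2 ?increment_Lfun2// -mulrDr.
rewrite ler_wpM2l ?sqr_ge0// mean_sqr_superadditive//.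
by rewrite leq_mul2r leqnSn orbT.
Qed.

Lemma block_scaled_block (c : R) (l j : nat) w : (0 < l)%N ->
  block X c l j w = (c * Num.sqrt l%:R) * scaled_block X l j.+1 w.
Proof.
move=> l0; rewrite /block /scaled_block/= -mulrA [Num.sqrt _ * _]mulrC divfK//.
by rewrite gt_eqF// sqrtr_gt0 ltr0n.
Qed.

Lemma mean_scaled_block l j : mean P (scaled_block X l j) = 0.
Proof.
have I2 := increment_Lfun2 X2; have S2 := partial_sum_Lfun2 X2.
rewrite (@eq_mean _ _ _ P _ (fun w => (Num.sqrt l%:R)^-1 * (S (j * l) w - S (j.-1 * l) w))).
  by rewrite meanZ ?Lfun21// meanB ?Lfun21// !mean_partial_sum// subrr mulr0.
by move=> w; rewrite /scaled_block mulrC.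
Qed.

Lemma scaled_block_Lfun2 l j : scaled_block X l j \in Lfun P 2%:E.
Proof.
have I2 := increment_Lfun2 X2.
rewrite (_ : scaled_block X l j = fun w => (Num.sqrt l%:R)^-1 * (S (j * l) w - S (j.-1 * l) w)).
  by rewrite LfunZ ?ler1n.
by apply/funext => w; rewrite /scaled_block mulrC.
Qed.

Lemma variance_scaled_block (s : R) (l j : nat) : (0 < l)%N ->
  ((l%:R / s ^+ 2)%R%:E * 'V_P[scaled_block X l j.+1])%E =
  (mean P (fun w => block X s^-1 l j w ^+ 2))%:E.
Proof.
move=> l0; rewrite variance_mean_sqr ?mean_scaled_block ?scaled_block_Lfun2//.
rewrite -EFinM -meanZ ?Lfun2_sqr ?scaled_block_Lfun2//; congr (_%:E).
apply: eq_mean => w; rewrite block_scaled_block// (exprMn _ (s^-1 * _)) (exprMn _ s^-1) sqr_sqrtr// exprVn.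
by rewrite [l%:R / _]mulrC.
Qed.

Lemma power_scaled_block (s p : R) (l j : nat) : (0 < l)%N -> 0 < s ->
  ((l%:R `^ (p / 2) / s `^ p)%R%:E * 'E_P[fun w => (`|scaled_block X l j.+1 w| `^ p)%R])%E =
  'E_P[fun w => (`|block X s^-1 l j w| `^ p)%R]%E.
Proof.
move=> l0 s0; rewrite unlock -ge0_integralZl_EFin//; last 2 first.
- apply/measurable_EFinP; apply: (measurableT_comp (measurable_powR _)) => //.
  by apply: measurableT_comp => //; exact: Lfun_measurable (scaled_block_Lfun2 _ _).
- by rewrite divr_ge0 ?powR_ge0.
apply: eq_integral => w _; rewrite -EFinM; congr (_%:E).
rewrite block_scaled_block// (normrM (s^-1 * _)) powRM//.
rewrite (normrM s^-1) [`|s^-1|]gtr0_norm ?invr_gt0// ger0_norm// powRM ?invr_ge0 ?(ltW s0)//.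
rewrite -(powR12_sqrt (ler0n _ l)) -powRrM [2^-1 * p]mulrC.
by rewrite [_ / s `^ p]mulrC -powRN -[s^-1]powR_inv1 ?(ltW s0)// -powRrM mulN1r.
Qed.

Lemma lyapunov_sum (c eta delta : R) (l m : nat) : 0 < eta -> 0 < delta ->
  ((\sum_(j < m) mean P (fun w => cubic_cut (block X c l j w)))%:E <=
   (eta * \sum_(j < m) mean P (fun w => block X c l j w ^+ 2))%:E +
   (eta^-1 `^ delta)%:E * \sum_(j < m) 'E_P[fun w => (`|block X c l j w| `^ (2 + delta))%R])%E.
Proof.
move=> eta0 delta0.
have mb j : measurable_fun setT (fun w => `|block X c l j w| `^ (2 + delta)).
  apply: (measurableT_comp (measurable_powR _)) => //.
  by apply: measurableT_comp => //; exact: Lfun_measurable (block_Lfun2 c l j).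
have pb_ge0 j : (0 <= 'E_P[fun w => (`|block X c l j w| `^ (2 + delta))%R])%E.
  by apply: expectation_ge0 => w; exact: powR_ge0.
rewrite mulr_sumr -sumEFin -sumEFin ge0_sume_distrr// -big_split/=.
apply: lee_sum => j _.
have b2 := block_Lfun2 c l j; have bb1 := Lfun2_sqr b2.
rewrite -(expectation_mean (cubic_cut_Lfun1 b2)) -meanZ// -expectation_mean ?LfunZ//.
rewrite unlock -ge0_integralZl_EFin//; last 2 first.
- exact/measurable_EFinP.
- exact: powR_ge0.
rewrite -ge0_integralD//; last 4 first.
- by move=> w _; rewrite lee_fin mulr_ge0 ?sqr_ge0// ltW.
- by apply/measurable_EFinP; apply: measurable_funM => //; exact: Lfun_measurable bb1.
- by move=> w _; rewrite -EFinM lee_fin mulr_ge0 ?powR_ge0.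
- by apply: emeasurable_funM => //; exact/measurable_EFinP.
apply: ge0_le_integral => //.
- by move=> w _; rewrite lee_fin cubic_cut_ge0.
- by apply/measurable_EFinP; exact: Lfun_measurable (cubic_cut_Lfun1 b2).
- apply: emeasurable_funD; first by apply/measurable_EFinP; apply: measurable_funM => //; exact: Lfun_measurable bb1.
  by apply: emeasurable_funM => //; exact/measurable_EFinP.
- by move=> w _; rewrite -EFinM -EFinD lee_fin cubic_cut_le_power.
Qed.

(** The form of [block_gauss_bound] in which every term of the bound tends to 0. *)
Lemma block_clt (l m : nat -> nat) (c : nat -> R) (s2 : R) : 0 <= s2 ->
  (\forall n \near \oo, (m n * l n <= n)%N) -> (forall n, 0 <= c n) ->
  let V n := \sum_(j < m n) mean P (fun w => block X (c n) (l n) j w ^+ 2) in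
  V n @[n --> \oo] --> s2 ->
  mean P (fun w => (c n * S (m n * l n)%N w) ^+ 2) - V n @[n --> \oo] --> (0 : R) ->
  (\sum_(j < m n) mean P (fun w => cubic_cut (block X (c n) (l n) j w))) @[n --> \oo] --> (0 : R) ->
  (\sum_(j < m n) mean P (fun w => block X (c n) (l n) j w ^+ 2) ^+ 2) @[n --> \oo] --> (0 : R) ->
  mean P (fun w => (c n * (S n w - S (m n * l n)%N w)) ^+ 2) @[n --> \oo] --> (0 : R) ->
  forall e a, 0 < e ->
  mean P (fun w => gauss e (c n * S n w - a)) @[n --> \oo] --> gauss (e + s2) (- a).
Proof.
move=> s20 mln c0 V cV cD cpsi cv crest e a e0.
have [C C0 gC] := gauss_regularP e0.
pose B n := 2 * C * (mean P (fun w => (c n * S (m n * l n)%N w) ^+ 2) - V n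
   + \sum_(j < m n) mean P (fun w => cubic_cut (block X (c n) (l n) j w))
   + \sum_(j < m n) mean P (fun w => block X (c n) (l n) j w ^+ 2) ^+ 2)
  + C * `|V n - s2|
  + C * Num.sqrt (mean P (fun w => (c n * (S n w - S (m n * l n)%N w)) ^+ 2)).
have cB : B n @[n --> \oo] --> (0 : R).
  rewrite (_ : 0 = 2 * C * (0 + 0 + 0) + C * `|s2 - s2| + C * Num.sqrt 0); last first.
    by rewrite sqrtr0 subrr normr0 !addr0 !mulr0 !addr0.
  apply: cvgD; first apply: cvgD.
  - by apply: cvgMr; do 2 apply: cvgD => //.
  - apply: cvgMr; apply: cvg_norm; apply: cvgB => //; exact: cvg_cst.
  - apply: cvgMr; apply: (@continuous_cvg _ _ _ _ _ _ (@Num.sqrt R)) => //.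
    exact: sqrt_continuous.
apply/cvgrPdist_le => eps eps0.
have /cvgrPdist_le/(_ _ eps0) hB := cB.
near=> n.
have hn : `|0 - B n| <= eps by near: n.
have mln_n : (m n * l n <= n)%N by near: n.
rewrite distrC; apply: le_trans (block_gauss_bound X_assoc X2 X0 a gC (lexx e) s20 (c0 n) mln_n) _.
by move: hn; rewrite sub0r normrN; apply: le_trans; exact: ler_norm.
Unshelve. all: by end_near. Qed.

End BlockMoments.

(** * The Lyapunov theorem for associated sequences *)

Section Lyapunov.
Context d (T : measurableType d) (R : realType) (P : probability T R).
Variable X : nat -> {RV P >-> R}.
Hypotheses (X_assoc : associated X) (X2 : forall i, (X i : T -> R) \in Lfun P 2%:E).
Hypothesis X0 : forall i, mean P (X i) = 0.
Local Notation S := (partial_sum X).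

Lemma weakly_converges_normal (c : nat -> R) (s2 K : R) : 0 <= s2 ->
  (forall n, mean P (fun w => (c n * S n w) ^+ 2) <= K) ->
  (forall e a, 0 < e ->
    mean P (fun w => gauss e (c n * S n w - a)) @[n --> \oo] --> gauss (e + s2) (- a)) ->
  weakly_converges P (fun n w => c n * S n w) (normal_law 0 s2).
Proof.
move=> s20 cK cg; have [id2 idm] := normal_law_second_moment s20.
have K0 : 0 <= K by apply: le_trans (cK 0%N); apply: mean_ge0 => w; exact: sqr_ge0.
apply: (@weakly_converges_gauss _ _ _ _ _ _ (K + 8 * s2)) => //.
- by rewrite addr_ge0// mulr_ge0.
- by move=> n; rewrite LfunZ ?ler1n ?partial_sum_Lfun2.
- by move=> n; rewrite (le_trans (cK n))// lerDl mulr_ge0.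
- by rewrite (le_trans idm)// lerDr.
- by move=> e a e0; rewrite mean_gauss_normal_law//; exact: cg.
Qed.

(** Let [V_n] be the sum of the normalized variances of the blocks.  By
    superadditivity [V_n] plus the normalized variance of the incomplete block is
    at most 1, the normalized variance of [S_n], and so is the normalized variance
    of the sum of the complete blocks.  As [V_n] tends to 1, the variance gap and the
    incomplete block are negligible.  The squares of the variances are bounded by
    their supremum times [V_n]. *)
Theorem associated_lyapunov_clt (l m r : nat -> nat) (delta : R) :
   0 < delta ->
   (forall n, (0 < n)%N -> (0 < l n)%N) ->
   (forall n, (0 < n)%N -> (n = m n * l n + r n)%N /\ (r n < l n)%N) ->
   (\forall n \near \oo, 0 < sum_std X n) ->
   (((l n)%:R / sum_std X n ^+ 2)%R%:E *
      \sum_(1 <= j < (m n).+1) 'V_P[scaled_block X (l n) j])%E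
     @[n --> \oo] --> 1%E ->
   ereal_sup [set (((l n)%:R / sum_std X n ^+ 2)%R%:E *
                   'V_P[scaled_block X (l n) j])%E
             | j in [set j : nat | (1 <= j <= (m n).+1)%N]]
     @[n --> \oo] --> 0%E ->
   (((l n)%:R `^ ((2 + delta) / 2) / sum_std X n `^ (2 + delta))%R%:E *
      \sum_(1 <= j < (m n).+1)
        'E_P[fun w => (`|scaled_block X (l n) j w| `^ (2 + delta))%R])%E
     @[n --> \oo] --> 0%E ->
   weakly_converges P (fun n w => S n w / sum_std X n) (normal_law 0 1).
Proof.
move=> delta0 l0 nmlr s0 hV hsup hL.
pose c n := (sum_std X n)^-1.
have S2 := partial_sum_Lfun2 X2; have I2 := increment_Lfun2 X2.
have c0 n : 0 <= c n by rewrite invr_ge0 sqrtr_ge0.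
have n0 : \forall n \near \oo, (0 < n)%N by exact: nbhs_infty_gt.
rewrite (_ : (fun n w => _) = (fun n w => c n * S n w)); last first.
  by apply/funext => n; apply/funext => w; rewrite mulrC.
have cS1 n : 0 < sum_std X n -> mean P (fun w => (c n * S n w) ^+ 2) = 1.
  by move=> sn0; rewrite mean_sqr_scale// -sum_std_sqr// -exprMn mulVf ?expr1n ?gt_eqF.
apply: (@weakly_converges_normal _ _ 1) => // [n|].
  (* If the standard deviation is 0, division by 0 makes the quotient vanish. *)
  have [sn0|] := ltP 0 (sum_std X n); first by rewrite cS1.
  rewrite le_eqVlt ltNge sqrtr_ge0 orbF => /eqP sn0.
  rewrite (@eq_mean _ _ _ P _ (fun=> 0)) ?mean_cst// => w.
  by rewrite /c sn0 invr0 mul0r expr0n.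
pose v n j := mean P (fun w => block X (c n) (l n) j w ^+ 2).
pose V n := \sum_(j < m n) v n j.
have v0 n j : 0 <= v n j by apply: mean_ge0 => w; exact: sqr_ge0.
have V0 n : 0 <= V n by exact: sumr_ge0.
have near_mln : \forall n \near \oo, (m n * l n <= n)%N.
  near=> n; have n_gt0 : (0 < n)%N by near: n.
  by rewrite [leqRHS](nmlr n n_gt0).1 leq_addr.
have VE n : (0 < n)%N -> (((l n)%:R / sum_std X n ^+ 2)%R%:E *
      \sum_(1 <= j < (m n).+1) 'V_P[scaled_block X (l n) j])%E = (V n)%:E.
  move=> n_gt0; rewrite big_add1 big_mkord/= ge0_sume_distrr; last first.
    by move=> j _; exact: variance_ge0.
  by rewrite -sumEFin; apply: eq_bigr => j _; rewrite variance_scaled_block// l0.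
have cV : V n @[n --> \oo] --> (1 : R).
  apply/cvgrPdist_le => eps eps0.
  have /fine_cvgP[_ /cvgrPdist_le/(_ _ eps0)] := hV.
  by apply: filterS2 n0 => n n_gt0; rewrite /= VE.
have decomp n : (m n * l n <= n)%N -> 0 < sum_std X n ->
    mean P (fun w => (c n * S (m n * l n)%N w) ^+ 2) +
    mean P (fun w => (c n * (S n w - S (m n * l n)%N w)) ^+ 2) <= 1.
  move=> mln sn0; rewrite -(cS1 n sn0) !mean_sqr_scale// -mulrDr ler_wpM2l ?sqr_ge0//.
  exact: mean_sqr_superadditive.
have VleS n := sum_blocks_le X_assoc X2 X0 (c n) (l n) (m n).
have sqr_mean_ge0 (f : T -> R) : 0 <= mean P (fun w => f w ^+ 2).
  by apply: mean_ge0 => w; exact: sqr_ge0.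
have c1V : 1 - V n @[n --> \oo] --> (0 : R).
  by rewrite -(subrr 1); apply: cvgB => //; exact: cvg_cst.
have zero_le_cvg (f : nat -> R) : (\forall n \near \oo, 0 <= f n <= 1 - V n) ->
    f n @[n --> \oo] --> (0 : R).
  by move=> fV; apply: (squeeze_cvgr fV) => //; exact: cvg_cst.
apply: (block_clt X_assoc X2 X0 (l := l) (m := m)) => //.
- apply: zero_le_cvg; near=> n.
  have mln : (m n * l n <= n)%N by near: n.
  have sn0 : 0 < sum_std X n by near: n.
  rewrite subr_ge0 VleS lerD2r/= (le_trans _ (decomp n mln sn0))//.
  by rewrite lerDl.
- apply/cvgrPdist_le => eps eps0.
  pose eta := eps / 4; have eta0 : 0 < eta by rewrite divr_gt0.
  pose k := eta^-1 `^ delta; have k0 : 0 < k by apply: powR_gt0; rewrite invr_gt0.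
  have ek0 : 0 < eps / (2 * k) by rewrite divr_gt0// mulr_gt0.
  have /fine_cvgP[Lfin Lcvg] := hL.
  have /cvgrPdist_le/(_ _ ek0) hLn := Lcvg.
  have /cvgrPdist_le/(_ _ ltr01) hV1 := cV.
  near=> n.
  have n_gt0 : (0 < n)%N by near: n.
  have sn0 : 0 < sum_std X n by near: n.
  have Vn1 : `|1 - V n| <= 1 by near: n.
  rewrite sub0r normrN ger0_norm; last first.
    by apply: sumr_ge0 => j _; apply: mean_ge0 => w; exact: cubic_cut_ge0.
  rewrite -lee_fin; apply: le_trans (lyapunov_sum X2 (c n) (l n) (m n) eta0 delta0) _.
  rewrite -/k -/(V n).
  have -> : (\sum_(j < m n) 'E_P[fun w => (`|block X (c n) (l n) j w| `^ (2 + delta))%R] =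
    ((l n)%:R `^ ((2 + delta) / 2) / sum_std X n `^ (2 + delta))%R%:E *
      \sum_(1 <= j < (m n).+1)
        'E_P[fun w => (`|scaled_block X (l n) j w| `^ (2 + delta))%R])%E.
    rewrite big_add1 big_mkord/= ge0_sume_distrr; last first.
      by move=> j _; apply: expectation_ge0 => w; exact: powR_ge0.
    by apply: eq_bigr => j _; rewrite power_scaled_block// l0.
  set L := (X in (_ + _ * X)%E).
  have Lf : L \is a fin_num by rewrite /L; near: n.
  have Ln : `|0 - fine L| <= eps / (2 * k) by rewrite /L; near: n.
  rewrite -(fineK Lf) -EFinM -EFinD lee_fin.
  have V2 : V n <= 2 by move: Vn1; rewrite distrC ler_norml => /andP[_]; lra.
  have h1 : eta * V n <= eps / 2 by apply: (@le_trans _ _ (eta * 2)); [rewrite ler_pM2l|rewrite /eta; lra].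
  have h2 : k * fine L <= eps / 2.
    rewrite mulrC -ler_pdivlMr// -mulrA -invfM (le_trans _ Ln)// sub0r normrN.
    exact: ler_norm.
  by rewrite (splitr eps) lerD.
- have /fine_cvgP[ufin ucvg] := hsup.
  set u := (X in fine \o X) in ucvg.
  have cuV : fine (u n) * V n @[n --> \oo] --> (0 : R).
    by rewrite -(mul0r 1); apply: cvgM.
  apply: (squeeze_cvgr _ (cvg_cst 0) cuV); near=> n.
  have n_gt0 : (0 < n)%N by near: n.
  have un : u n \is a fin_num by near: n.
  rewrite sumr_ge0/=; last by move=> j _; exact: sqr_ge0.
  rewrite mulr_sumr; apply: ler_sum => j _; rewrite expr2 ler_wpM2r ?v0//.
  rewrite -lee_fin (fineK un) /u; apply: ereal_sup_ubound; exists j.+1 => //=.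
    by rewrite (leq_trans (ltn_ord j)).
  by rewrite variance_scaled_block// l0.
- apply: zero_le_cvg; near=> n.
  have mln : (m n * l n <= n)%N by near: n.
  have sn0 : 0 < sum_std X n by near: n.
  rewrite sqr_mean_ge0/=; have := decomp n mln sn0; have := VleS n.
  rewrite -/(V n); move: (mean P _) (mean P _) => A B; lra.
Unshelve. all: by end_near. Qed.

End Lyapunov.

(** * Consequences of stationarity *)

Section Stationary.
Context d (T : measurableType d) (R : realType) (P : probability T R).
Variable X : nat -> {RV P >-> R}.
Hypothesis X_stat : stationary X.
Local Notation S := (partial_sum X).

Let tuple_sum n (x : n.-tuple R) := \sum_(i < n) tnth x i.

Let measurable_tuple_sum n : measurable_fun setT (@tuple_sum n).
Proof. by apply: measurable_sum => i; exact: measurable_tnth. Qed.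

Let measurable_subvector n (idx : 'I_n -> nat) : measurable_fun setT (subvector X idx).
Proof.
apply/measurable_fun_tnthP => i.
rewrite (_ : _ \o _ = X (idx i)); first exact: measurable_funPT.
by apply/funext => w /=; rewrite tnth_mktuple.
Qed.

Let increment_tuple_sum k n w :
  S (k + n)%N w - S k w = tuple_sum (subvector X (fun i : 'I_n => (k + i)%N) w).
Proof.
rewrite /tuple_sum /partial_sum big_split_ord/= addrAC subrr add0r.
by apply: eq_bigr => i _; rewrite tnth_mktuple.
Qed.

Lemma stationary_integral k n (G : R -> \bar R) : measurable_fun setT G ->
  (forall x, 0 <= G x)%E ->
  (\int[P]_w G (S (k + n)%N w - S k w)%R = \int[P]_w G (S n w))%E.
Proof.
move=> mG G0.
have mGs : measurable_fun setT (G \o @tuple_sum n).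
  exact: (measurableT_comp mG (@measurable_tuple_sum n)).
pose Zk := subvector X (fun i : 'I_n => (k + i)%N).
pose Z0 := subvector X (fun i : 'I_n => i : nat).
have eG (Z : T -> n.-tuple R) (mZ : measurable_fun setT Z) :
    (\int[P]_w G (tuple_sum (Z w)) = \int[pushforward P Z]_x (G \o @tuple_sum n) x)%E.
  by rewrite ge0_integral_pushforward// => y _; exact: G0.
under eq_integral do rewrite increment_tuple_sum.
rewrite (eG Zk (measurable_subvector _)).
have -> : (\int[P]_w G (S n w) = \int[P]_w G (tuple_sum (Z0 w)))%E.
  apply: eq_integral => w _; congr (G _); rewrite /tuple_sum.
  by apply: eq_bigr => i _; rewrite tnth_mktuple.
rewrite (eG Z0 (measurable_subvector _)).
apply: eq_measure_integral; [exact: (@measurable_subvector n)|exact: (@measurable_subvector n)|].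
by move=> mZ0 mZk A mA _; exact: X_stat.
Qed.


(** Stationarity enters only through the law of the increments [S_(k+n) - S_k]. *)
Lemma mean_stationary k n (G : R -> R) : measurable_fun setT G -> (forall x, 0 <= G x) ->
  mean P (fun w => G (S (k + n)%N w - S k w)) = mean P (fun w => G (S n w)).
Proof.
move=> mG G0; rewrite /mean /Rintegral; congr fine.
apply: (@stationary_integral k n (EFin \o G)); first exact/measurable_EFinP.
by move=> x; rewrite lee_fin.
Qed.

Lemma stationary_Lfun2 : ('E_P[fun w => (X 0%N w ^+ 2)%R] < +oo)%E ->
  forall i, (X i : T -> R) \in Lfun P 2%:E.
Proof.
rewrite unlock => X02 i; apply: Lfun2P => //.
have msq : measurable_fun setT (fun x : R => (x ^+ 2)%:E).
  by apply/measurable_EFinP; apply: measurable_funX; exact: measurable_id.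
have := @stationary_integral i 1 _ msq (fun x => sqr_ge0 x).
have Xi w : S (i + 1)%N w - S i w = X i w.
  by rewrite addn1 /partial_sum big_ord_recr/= addrAC subrr add0r.
under eq_integral do rewrite Xi.
under [RHS]eq_integral do rewrite /partial_sum big_ord1.
move=> e; apply/Lfun1_integrable/integrableP; split.
  by apply/measurable_EFinP; exact: measurable_funX.
by under eq_integral do rewrite /= ger0_norm ?sqr_ge0//; rewrite e.
Qed.

End Stationary.

(** * The Lindeberg term of a fixed variable *)

Section Rescaling.
Context d (T : measurableType d) (R : realType) (P : probability T R).

Lemma cvg_inv_nat : (n%:R : R)^-1 @[n --> \oo] --> (0 : R).
Proof.
apply/gtr0_cvgV0; last exact: cvgr_idn.
by near=> n; rewrite ltr0n; near: n; exact: nbhs_infty_gt.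
Unshelve. all: by end_near. Qed.

(** [n * cubic_cut (f / sqrt n)] is at most [f^2] and at most [|f|^3 / sqrt n]:
    dominated convergence applies with second moments only. *)
Lemma lindeberg_cubic_cut (f : T -> R) : f \in Lfun P 2%:E ->
  n%:R * mean P (fun w => cubic_cut ((Num.sqrt n%:R)^-1 * f w)) @[n --> \oo] --> (0 : R).
Proof.
move=> f2; pose c n : R := (Num.sqrt n%:R)^-1.
have c0 n : 0 <= c n by rewrite invr_ge0 sqrtr_ge0.
have nc2 n : n%:R * c n ^+ 2 <= 1.
  rewrite /c exprVn sqr_sqrtr//; case: n => [|n]; first by rewrite mul0r.
  by rewrite divff.
have cc : c n @[n --> \oo] --> (0 : R).
  rewrite (_ : c = Num.sqrt \o (fun n => n%:R^-1)); last first.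
    by apply/funext => n; rewrite /c /= sqrtrV.
  rewrite -[X in _ --> X]sqrtr0; apply: (@continuous_cvg _ _ _ _ _ _ (@Num.sqrt R)).
    exact: sqrt_continuous.
  exact: cvg_inv_nat.
pose q n w := n%:R * cubic_cut (c n * f w).
have cf2 n : (fun w => c n * f w) \in Lfun P 2%:E by rewrite LfunZ ?ler1n.
have q1 n : q n \in Lfun P 1 by apply: (LfunZ _ (lexx 1)); exact: cubic_cut_Lfun1.
have q_ge0 n w : 0 <= q n w by rewrite mulr_ge0// cubic_cut_ge0.
have qf n w : q n w <= f w ^+ 2.
  apply: (@le_trans _ _ (n%:R * (c n * f w) ^+ 2)).
    by rewrite ler_wpM2l// ge_min lexx.
  by rewrite exprMn mulrA -[leRHS]mul1r ler_wpM2r ?sqr_ge0.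
have q0 w : q n w @[n --> \oo] --> (0 : R).
  apply: (@squeeze_cvgr _ _ _ _ (cst 0) (fun n => c n * `|f w| ^+ 3)).
  - apply: nearW => n; rewrite q_ge0/=.
    apply: (@le_trans _ _ (n%:R * `|c n * f w| ^+ 3)).
      by rewrite ler_wpM2l// ge_min lexx orbT.
    rewrite normrM (ger0_norm (c0 n)) exprMn mulrA ler_wpM2r ?exprn_ge0//.
    by rewrite exprSr mulrA ler_piMl.
  - exact: cvg_cst.
  - by rewrite -[X in _ --> X](mul0r (`|f w| ^+ 3)); apply: cvgMl.
have mq n := Lfun_measurable (q1 n).
have [|||||_ _ cvgq] := @dominated_convergence _ _ _ P setT measurableT
    (fun n w => (q n w)%:E) (cst 0%E) (EFin \o (fun w => f w ^+ 2)).
- by move=> n; exact/measurable_EFinP.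
- exact: measurable_cst.
- by apply: nearW => w _; apply/fine_cvgP; split; [exact: nearW|exact: q0].
- by apply/Lfun1_integrable; exact: Lfun2_sqr.
- by apply: nearW => w n _; rewrite gee0_abs ?lee_fin.
rewrite (_ : (fun n => _) = (fun n => mean P (q n))); last first.
  by apply/funext => n; rewrite meanZ// cubic_cut_Lfun1.
by apply: fine_cvg; rewrite integral0 in cvgq.
Unshelve. all: by end_near. Qed.

End Rescaling.

(** * The central limit theorem for stationary associated sequences *)

Section Newman.
Context d (T : measurableType d) (R : realType) (P : probability T R).
Variable X : nat -> {RV P >-> R}.
Hypotheses (X_assoc : associated X) (X_stat : stationary X).
Hypothesis X2 : forall i, (X i : T -> R) \in Lfun P 2%:E.
Hypothesis X0 : forall i, mean P (X i) = 0.
Hypothesis sigma_fin : (limit_variance X < +oo)%E.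
Local Notation S := (partial_sum X).
Let A n := mean P (fun w => S n w ^+ 2).
Let gamma j := cov P (X 0) (X j).
Let sigma2 := fine (limit_variance X).

Let S2 n : S n \in Lfun P 2%:E.
Proof. exact: partial_sum_Lfun2. Qed.

Let I2 n k : (fun w => S n w - S k w) \in Lfun P 2%:E.
Proof. exact: increment_Lfun2. Qed.

Let A_ge0 n : 0 <= A n.
Proof. by apply: mean_ge0 => w; exact: sqr_ge0. Qed.

Let A_increment k n : mean P (fun w => (S (k + n)%N w - S k w) ^+ 2) = A n.
Proof.
apply: (@mean_stationary _ _ _ _ _ X_stat k n (fun x => x ^+ 2)) => [|x]; last exact: sqr_ge0.
by apply: measurable_funX; exact: measurable_id.
Qed.

Let gamma_ge0 j : 0 <= gamma j.
Proof.
rewrite -lee_fin -covariance_cov//.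
pose i0 : 'I_j.+1 := ord0; pose ij : 'I_j.+1 := ord_max.
pose Z := subvector X (fun i : 'I_j.+1 => i : nat).
have Zi (i : 'I_j.+1) : (tnth (T := R))^~ i \o Z = X i.
  by apply/funext => w; rewrite /= tnth_mktuple.
have := X_assoc (@ord_inj j.+1) (h := (tnth (T := R))^~ i0) (g := (tnth (T := R))^~ ij).
rewrite -/Z !Zi; apply.
- by move=> x y; apply.
- by move=> x y; apply.
- exact: Lfun21.
- exact: Lfun21.
- have := Lfun2M (X2 0) (X2 j).
  by rewrite (_ : (fun w => X 0 w * X j w) = (fun w => tnth (Z w) i0 * tnth (Z w) ij))//;
    apply/funext => w; rewrite !tnth_mktuple.
Qed.

Let A0 : A 0 = 0.
Proof.
rewrite /A (@eq_mean _ _ _ P _ (fun=> 0)) ?mean_cst// => w.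
by rewrite /partial_sum big_ord0 expr0n.
Qed.

Let A_succ k : A k.+1 - A k = A 1 + 2 * \sum_(1 <= j < k.+1) gamma j.
Proof.
have X02 := X2 0.
have S1 w : S 1 w = X 0 w by rewrite /partial_sum big_ord1.
(* Splitting off the first variable, rather than the last one, leaves the
   increment [S_(k+1) - S_1], which has the law of [S_k]. *)
rewrite -[in LHS](A_increment 1 k) add1n.
have E w : S k.+1 w ^+ 2 = (S 1 w) ^+ 2 +
   (2 * (X 0 w * (S k.+1 w - S 1 w)) + (S k.+1 w - S 1 w) ^+ 2).
  by rewrite S1; ring.
have XI1 := Lfun2M X02 (I2 k.+1 1).
rewrite {1}/A (eq_mean P E) meanD ?Lfun2_sqr//; last first.
  by rewrite LfunD// ?LfunZ// Lfun2_sqr.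
rewrite meanD ?LfunZ ?Lfun2_sqr// meanZ// -/(A 1) addrA addrK; congr (_ + _ * _).
rewrite big_add1 big_mkord/=.
have -> : mean P (fun w => X 0 w * (S k.+1 w - S 1 w)) =
    mean P (fun w => \sum_(j < k) X 0 w * X j.+1 w).
  apply: eq_mean => w; rewrite -mulr_sumr; congr (_ * _).
  by rewrite /partial_sum big_ord_recl big_ord1/= addrAC subrr add0r.
rewrite (@mean_sum _ _ _ P k (fun j w => X 0 w * X j.+1 w)); last first.
  by move=> j; exact: Lfun2M.
by apply: eq_bigr => j _; rewrite /gamma /cov X0 mul0r subr0.
Qed.

Let g k := A k.+1 - A k.

Let series_cov_finite :
  (\sum_(1 <= j <oo) (gamma j)%:E < +oo)%E /\
  limit_variance X = ((A 1)%:E + 2%:E * \sum_(1 <= j <oo) (gamma j)%:E)%E.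
Proof.
have S1 : (X 0 : T -> R) = S 1.
  by apply/funext => w; rewrite /partial_sum big_ord1.
have E : limit_variance X = ((A 1)%:E + 2%:E * \sum_(1 <= j <oo) (gamma j)%:E)%E.
  rewrite /limit_variance variance_mean_sqr// /A -S1; congr (_ + _ * _)%E.
  by apply: eq_eseriesr => j _; rewrite covariance_cov.
split => //; move: sigma_fin; rewrite E.
have : (0 <= \sum_(1 <= j <oo) (gamma j)%:E)%E.
  by apply: nneseries_ge0 => j _ _; rewrite lee_fin.
case: (\sum_(1 <= j <oo) _)%E => [x _ _|_|//]; first exact: ltry.
by rewrite gt0_muley ?lte_fin// addey.
Qed.

Let g_cvg : g k @[k --> \oo] --> sigma2.
Proof.
have [sfin E] := series_cov_finite.
have sge0 : (0 <= \sum_(1 <= j <oo) (gamma j)%:E)%E.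
  by apply: nneseries_ge0 => j _ _; rewrite lee_fin.
have sf : (\sum_(1 <= j <oo) (gamma j)%:E)%E \is a fin_num by rewrite ge0_fin_numE.
have := @is_cvg_nneseries R (fun j => (gamma j)%:E) xpredT 1 (fun j _ _ => gamma_ge0 j).
rewrite -(fineK sf) => /fine_cvgP[_ h].
have -> : g = fun k => A 1 + 2 * \sum_(1 <= j < k.+1) gamma j.
  by apply/funext => k; exact: A_succ.
rewrite /sigma2 E -(fineK sf) -EFinM -EFinD /=.
apply: cvgD; first exact: cvg_cst.
apply: cvgMr; rewrite (cvg_shiftS (fun k => \sum_(1 <= j < k) gamma j)).
rewrite (_ : (fun k => \sum_(1 <= j < k) gamma j) =
  fine \o (fun n => (\sum_(1 <= i < n) (gamma i)%:E)%E)); first exact: h.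
by apply/funext => k /=; rewrite sumEFin.
Qed.

Let g_le k : g k <= sigma2.
Proof.
have g_nd : {homo g : a b / (a <= b)%N >-> a <= b}.
  apply/nondecreasing_seqP => n; rewrite /g !A_succ lerD2l ler_pM2l//.
  by rewrite [leRHS]big_nat_recr//= lerDl.
rewrite -(cvg_lim (@Rhausdorff R) g_cvg).
by apply: nondecreasing_cvgn_le => //; exact: cvgP g_cvg.
Qed.

Let A_le n : A n <= n%:R * sigma2.
Proof.
elim: n => [|n ih]; first by rewrite A0 mul0r.
have := g_le n; rewrite /g lerBlDr => /le_trans; apply.
by rewrite -natr1 mulrDl mul1r addrC lerD2r.
Qed.

Let sigma2_ge0 : 0 <= sigma2.
Proof. by have := A_le 1; rewrite mul1r; apply: le_trans. Qed.

Let A_mean_cvg : A n.+1 / n.+1%:R @[n --> \oo] --> sigma2.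
Proof.
rewrite (_ : (fun n => _) = arithmetic_mean g); first exact: cesaro g_cvg.
apply/funext => n.
rewrite /arithmetic_mean /= [RHS]mulrC; congr (_ / _).
rewrite /series/= /g; elim: n => [|n ih].
  by rewrite big_nat1 A0 subr0.
by rewrite big_nat_recr//= ih addrC subrK.
Qed.

(** For blocks of fixed length [l] the variance gap is at most
    [sigma^2 - Var(S_l) / l], because [Var(S_k) <= k sigma^2] for all [k].  The
    length [l] is chosen to make this small; the other terms of the bound tend to
    0 with [n]. *)
Theorem associated_stationary_clt :
  weakly_converges P (fun n w => S n w / Num.sqrt n%:R)
    (normal_law 0 (fine (limit_variance X))).
Proof.
rewrite -/sigma2.
pose c n : R := (Num.sqrt n%:R)^-1.
have c0 n : 0 <= c n by rewrite invr_ge0 sqrtr_ge0.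
have c2 n : c n ^+ 2 = n%:R^-1 by rewrite /c exprVn sqr_sqrtr.
rewrite (_ : (fun n w => _) = (fun n w => c n * S n w)); last first.
  by apply/funext => n; apply/funext => w; rewrite mulrC.
apply: (weakly_converges_normal X2 (K := sigma2)) => // [n|e a e0].
  rewrite mean_sqr_scale// c2 mulrC; case: n => [|n]; first by rewrite invr0 mulr0.
  by rewrite ler_pdivrMr ?ltr0n// mulrC A_le.
have [C C0 gC] := gauss_regularP e0.
apply/cvgrPdist_le => eps eps0.
(* The variance gap and the distance from [b] to [sigma2] enter the bound as
   [3 C eta], which is half of [eps]. *)
pose eta := eps / (6 * C); have eta0 : 0 < eta by rewrite divr_gt0// mulr_gt0.
have /cvgrPdist_le/(_ _ eta0)[L _ /(_ L (leqnn L))/= hL] := A_mean_cvg.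
pose l := L.+1; pose b := A l / l%:R.
have bs : b <= sigma2 by rewrite /b ler_pdivrMr ?ltr0n// mulrC A_le.
have sb : sigma2 - b <= eta by apply: le_trans (ler_norm _) hL.
have b0 : 0 <= b by rewrite divr_ge0.
pose psi n := n%:R * mean P (fun w => cubic_cut (c n * S l w)).
pose B n := 2 * C * (psi n + A l ^+ 2 * n%:R^-1) + C * (A l * n%:R^-1)
  + C * Num.sqrt (l%:R * sigma2 * n%:R^-1).
have inv0 : (n%:R : R)^-1 @[n --> \oo] --> (0 : R) by exact: cvg_inv_nat.
have cB : B n @[n --> \oo] --> (0 : R).
  rewrite (_ : 0 = 2 * C * (0 + A l ^+ 2 * 0) + C * (A l * 0) + C * Num.sqrt (l%:R * sigma2 * 0)); last first.
    by rewrite !mulr0 sqrtr0 !addr0 !mulr0 !addr0.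
  apply: cvgD; first apply: cvgD.
  - apply: cvgMr; apply: cvgD; last exact: cvgMr.
    exact: lindeberg_cubic_cut.
  - by apply: cvgMr; exact: cvgMr.
  - apply: cvgMr; apply: (@continuous_cvg _ _ _ _ _ _ (@Num.sqrt R)).
      exact: sqrt_continuous.
    exact: cvgMr.
have eps20 : 0 < eps / 2 by rewrite divr_gt0.
have /cvgrPdist_le/(_ _ eps20) hB := cB.
near=> n.
have n0 : (0 < n)%N by near: n; exact: nbhs_infty_gt.
have Bn : B n <= eps / 2.
  have : `|0 - B n| <= eps / 2 by near: n.
  by rewrite sub0r normrN; apply: le_trans; exact: ler_norm.
pose m := (n %/ l)%N.
have mln : (m * l <= n)%N by exact: leq_trunc_div.
rewrite distrC; apply: le_trans (block_gauss_bound X_assoc X2 X0 a gC (lexx e) sigma2_ge0 (c0 n) mln) _.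
have n0R : 0 < n%:R :> R by rewrite ltr0n.
have l0R : 0 < l%:R :> R by rewrite ltr0n.
have mn : m%:R * l%:R <= n%:R :> R by rewrite -natrM ler_nat.
have m_le_n : m%:R <= n%:R :> R by rewrite ler_nat leq_div.
have nml : n%:R - m%:R * l%:R <= l%:R :> R.
  rewrite [in leLHS](divn_eq n l) -/m natrD natrM addrAC subrr add0r ler_nat.
  by rewrite ltnW// ltn_mod.
have bE : A l = b * l%:R by rewrite /b divfK// gt_eqF.
have block_shift (G : R -> R) j : measurable_fun setT G -> (forall x, 0 <= G x) ->
    mean P (fun w => G (block X (c n) l j w)) = mean P (fun w => G (c n * S l w)).
  move=> mG G0.
  have mGc : measurable_fun setT (fun x => G (c n * x)).
    by apply: (measurableT_comp mG); apply: measurable_funM => //; exact: measurable_id.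
  rewrite /block mulSn addnC.
  exact: (mean_stationary X_stat (j * l) l mGc (fun x => G0 _)).
have msq : measurable_fun setT (fun x : R => x ^+ 2).
  by apply: measurable_funX; exact: measurable_id.
have vE j : mean P (fun w => block X (c n) l j w ^+ 2) = A l / n%:R.
  by rewrite (block_shift (fun x => x ^+ 2) j msq (@sqr_ge0 R)) mean_sqr_scale// c2 mulrC.
have psiE j : mean P (fun w => cubic_cut (block X (c n) l j w)) =
    mean P (fun w => cubic_cut (c n * S l w)).
  exact: (block_shift _ j (@measurable_cubic_cut R) (@cubic_cut_ge0 R)).
have const_sum (F : nat -> R) x : (forall j, F j = x) -> \sum_(j < m) F j = m%:R * x.
  move=> Fx; rewrite (eq_bigr (fun=> x)) => [|j _]; last exact: Fx.
  by rewrite sumr_const card_ord mulr_natl.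
rewrite (const_sum _ _ vE) (const_sum _ _ psiE).
rewrite (const_sum (fun j => mean P (fun w => block X (c n) l j w ^+ 2) ^+ 2) ((A l / n%:R) ^+ 2)); last first.
  by move=> j; rewrite vE.
have t1 : mean P (fun w => (c n * S (m * l)%N w) ^+ 2) - m%:R * (A l / n%:R) <= eta.
  apply: le_trans sb; rewrite mean_sqr_scale// c2 mulrA [_^-1 * _]mulrC -mulrBl.
  rewrite ler_pdivrMr// bE; apply: (@le_trans _ _ ((m%:R * l%:R) * (sigma2 - b))).
    have := A_le (m * l)%N; rewrite natrM -/(A (m * l)%N); lra.
  by rewrite mulrC ler_wpM2l// subr_ge0.
have t2 : m%:R * mean P (fun w => cubic_cut (c n * S l w)) <= psi n.
  by rewrite ler_wpM2r// mean_ge0// => w; exact: cubic_cut_ge0.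
have t3 : m%:R * (A l / n%:R) ^+ 2 <= A l ^+ 2 * n%:R^-1.
  apply: (@le_trans _ _ (n%:R * (A l / n%:R) ^+ 2)); first by rewrite ler_wpM2r ?sqr_ge0.
  by rewrite le_eqVlt; apply/orP; left; apply/eqP; field; rewrite gt_eqF.
have t4 : `|m%:R * (A l / n%:R) - sigma2| <= eta + A l * n%:R^-1.
  have mb : m%:R * (A l / n%:R) = b * (m%:R * l%:R / n%:R) by rewrite bE; field; rewrite gt_eqF.
  have q1 : m%:R * l%:R / n%:R <= 1 :> R by rewrite ler_pdivrMr// mul1r.
  have q2 : 1 - m%:R * l%:R / n%:R <= l%:R / n%:R :> R.
    by rewrite -[X in X - _](divff (lt0r_neq0 n0R)) -mulrBl ler_wpM2r// invr_ge0 ltW.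
  have q3 : b * (m%:R * l%:R / n%:R) <= b by rewrite ler_piMr.
  have q4 : b * (1 - m%:R * l%:R / n%:R) <= b * (l%:R / n%:R) by rewrite ler_wpM2l.
  rewrite mb ler0_norm ?subr_le0 ?(le_trans q3)//.
  have -> : A l * n%:R^-1 = b * (l%:R / n%:R) by rewrite bE mulrA.
  rewrite [leLHS](_ : _ = (sigma2 - b) + b * (1 - m%:R * l%:R / n%:R)); last by ring.
  exact: lerD.
have t5 : Num.sqrt (mean P (fun w => (c n * (S n w - S (m * l)%N w)) ^+ 2)) <=
    Num.sqrt (l%:R * sigma2 * n%:R^-1).
  apply: ler_wsqrtr; rewrite mean_sqr_scale// c2 mulrC ler_wpM2r ?invr_ge0 ?(ltW n0R)//.
  have -> : mean P (fun w => (S n w - S (m * l)%N w) ^+ 2) = A (n - m * l)%N.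
    by rewrite -(A_increment (m * l)%N) subnKC.
  apply: (le_trans (A_le _)); rewrite ler_wpM2r// natrB// natrM; exact: nml.
have etaE : 3 * C * eta = eps / 2 by rewrite /eta; field; rewrite gt_eqF.
apply: (@le_trans _ _ (2 * C * (eta + psi n + A l ^+ 2 * n%:R^-1) +
    C * (eta + A l * n%:R^-1) + C * Num.sqrt (l%:R * sigma2 * n%:R^-1))).
  have C0' := ltW C0.
  apply: lerD; last by rewrite ler_wpM2l.
  apply: lerD; last by rewrite ler_wpM2l.
  by rewrite ler_wpM2l ?mulr_ge0//; apply: lerD => //; exact: lerD.
rewrite (splitr eps) -[X in _ <= _ + X]etaE.
apply: le_trans (lerD Bn (lexx _)); rewrite /B le_eqVlt; apply/orP; left; apply/eqP.
ring.
Unshelve. all: by end_near. Qed.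

End Newman.

(** * The two limit theorems *)

Theorem theorem4 (d : measure_display) (T : measurableType d) (R : realType)
    (P : probability T R) (X : nat -> {RV P >-> R})
    (X_assoc : associated X)
    (X_int : forall i : nat, (X i : T -> R) \in Lfun P 1)
    (X_mean0 : forall i : nat, ('E_P[X i] = 0)%E) :
  (stationary X ->
   ('E_P[fun w => (X 0%N w ^+ 2)%R] < +oo)%E ->
   (limit_variance X < +oo)%E ->
   weakly_converges P (fun n w => partial_sum X n w / Num.sqrt n%:R)
     (normal_law 0 (fine (limit_variance X))))
  /\
  (forall (l m r : nat -> nat) (delta : R),
   0 < delta ->
   (forall n, (0 < n)%N -> (0 < l n)%N) ->
   (forall n, (0 < n)%N -> (n = m n * l n + r n)%N /\ (r n < l n)%N) ->
   (\forall n \near \oo, 0 < sum_std X n) ->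
   m n @[n --> \oo] --> \oo ->
   (l n)%:R / n%:R @[n --> \oo] --> (0 : R) ->
   (r n)%:R / n%:R @[n --> \oo] --> (0 : R) ->
   (l n)%:R / sum_std X n ^+ 2 @[n --> \oo] --> (0 : R) ->
   (((l n)%:R / sum_std X n ^+ 2)%R%:E *
      \sum_(1 <= j < (m n).+1) 'V_P[scaled_block X (l n) j])%E
     @[n --> \oo] --> 1%E ->
   ereal_sup [set (((l n)%:R / sum_std X n ^+ 2)%R%:E *
                   'V_P[scaled_block X (l n) j])%E
             | j in [set j : nat | (1 <= j <= (m n).+1)%N]]
     @[n --> \oo] --> 0%E ->
   (forall i : nat, ('E_P[fun w => (`|X i w| `^ (2 + delta))%R] < +oo)%E) ->
   (((l n)%:R `^ ((2 + delta) / 2) / sum_std X n `^ (2 + delta))%R%:E *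
      \sum_(1 <= j < (m n).+1)
        'E_P[fun w => (`|scaled_block X (l n) j w| `^ (2 + delta))%R])%E
     @[n --> \oo] --> 0%E ->
   weakly_converges P (fun n w => partial_sum X n w / sum_std X n)
     (normal_law 0 1)).
Proof.
have X0 i : mean P (X i) = 0.
  by apply: EFin_inj; rewrite -expectation_mean.
split.
  move=> X_stat X02 sigma_fin; have X2 := stationary_Lfun2 X_stat X02.
  exact: associated_stationary_clt.
move=> l m r delta delta0 l0 nmlr s0 _ _ _ _ hV hsup hmom hL.
have X2 i : (X i : T -> R) \in Lfun P 2%:E.
  apply: (@Lfun2_of_power _ _ _ _ _ (2 + delta)) => //.
  by rewrite lerDl ltW.
exact: (associated_lyapunov_clt X_assoc X2 X0 delta0 l0 nmlr s0 hV hsup hL).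
Qed.
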